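(* There is a universal constant $c>0$ such that for every $d\ge1$, every convex body $K\subset\mathbb{R}^d$ and every $p\in\mathrm{int}(K)$, \[\kappa'(K,p)>c\left(\frac{2}{\sqrt3}\right)^d.\]
   Context: A convex body in $\mathbb{R}^d$ is a compact convex set with non-empty interior. A positive homothet of $K$ is a set $\lambda K+v$ with $\lambda>0$, $v\in\mathbb{R}^d$. For $p\in\mathrm{int}(K)$, a strict Minkowski arrangement of $K$ with respect to $p$ is a family $\{v_i+\lambda_iK\}$ of positive homothets of $K$ such that $v_i+p\notin v_j+\lambda_jK$ for all distinct $i,j$. $\kappa'(K,p)$ is the largest number of homothets in a pairwise intersecting (any two members intersect) strict Minkowski arrangement of $K$ with respect to $p$. *)

(* Defs.v *)
From HB Require Import structures.
From mathcomp Require Import all_boot all_order all_algebra.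
From mathcomp Require Import all_classical all_reals all_analysis.
Set Implicit Arguments. Unset Strict Implicit. Unset Printing Implicit Defensive.
Import Order.TTheory GRing.Theory Num.Theory.
Import numFieldNormedType.Exports.
Local Open Scope classical_set_scope.
Local Open Scope ring_scope.

Definition convex_body_set {R : realType} {d : nat} (K : set 'rV[R]_d) : Prop :=
  forall x y t, K x -> K y -> 0 <= t -> t <= 1 -> K ((1 - t) *: x + t *: y).

Definition convex_body {R : realType} {d : nat} (K : set 'rV[R]_d) : Prop :=
  [/\ compact K, convex_body_set K & interior K !=set0].

Definition homothet {R : realType} {d : nat} (K : set 'rV[R]_d)
  (v : 'rV[R]_d) (lam : R) : set 'rV[R]_d :=
  [set v + lam *: x | x in K].

Definition pi_strict_minkowski_arrangement {R : realType} {d n : nat}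
  (K : set 'rV[R]_d) (p : 'rV[R]_d) (v : 'I_n -> 'rV[R]_d) (lam : 'I_n -> R)
  : Prop :=
  [/\ (forall i, 0 < lam i),
      (forall i j, i != j -> ~ homothet K (v j) (lam j) (v i + p))
    & (forall i j, homothet K (v i) (lam i) `&` homothet K (v j) (lam j) !=set0)].

(* kappa'(K,p) > r  iff some pairwise intersecting strict Minkowski
   arrangement of K w.r.t. p has more than r members (kappa' is the largest
   such number, i.e. the supremum of the achievable sizes). *)
Definition kappa'_gt {R : realType} {d : nat} (K : set 'rV[R]_d) (p : 'rV[R]_d)
  (r : R) : Prop :=
  exists n (v : 'I_n -> 'rV[R]_d) (lam : 'I_n -> R),
    pi_strict_minkowski_arrangement K p v lam /\ r < n%:R.

(* Main.v *)
(** Translates suffice: with [L = K - p] one needs points of [L] none of whose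
    differences lies in [L]. By Turán's bound, [N] points spanning [T] bad ordered
    pairs [(x, y)], [x - y \in L], contain an independent set of size at least
    [N^2 / (2 T)]. Take for points the lattice points of a large dilate [t L]; then
    [T <= 4 (sqrt 3 / 2)^d N^2] by the sharp Young inequality
    [∫∫ f(x) g(y) h(x - y) <= (sqrt 3 / 2)^d |f|_(3/2) |g|_(3/2) |h|_(3/2)],
    applied to indicator functions. A discrete version, in which [h] is replaced by
    its minimum over a bounded window, is enough, because [(1 + e) t L] contains the
    window around [t L], and along a suitable sequence of [t] the dilate
    [(1 + e) t L] has at most [8 N] lattice points: the count grows polynomially.

    The multidimensional Young inequality follows from the one-dimensional one by
    summing over one coordinate at a time. In dimension one, following Barthe, [f]
    and [g] are transported to a common Gaussian: the quantiles [x_a], [y_b] of the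
    two densities with respect to a discrete Gaussian cut the plane into cells, the
    intervals [[x_a + y_b, x_(a+1) + y_(b+1)]] are consecutive along diagonals, and
    Hölder's inequality on each cell and then along each diagonal reduces the claim
    to a computation with Gaussian sums, where the constant [sqrt 3 / 2] arises. *)

Require Import Defs.
From HB Require Import structures.
From mathcomp Require Import all_boot all_order all_algebra.
From mathcomp Require Import all_classical all_reals all_analysis.
From mathcomp Require Import zify ring lra.
Set Implicit Arguments. Unset Strict Implicit. Unset Printing Implicit Defensive.
Import Order.TTheory GRing.Theory Num.Theory.
Import numFieldNormedType.Exports.
Local Open Scope classical_set_scope.
Local Open Scope ring_scope.

(** * Cube roots, growth and independent sets *)

Section CubeRoots.
Context {R : realType}.
Implicit Types (x y : R).

Definition cbrt x : R := x `^ 3^-1.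

Lemma cbrt_ge0 x : 0 <= cbrt x.
Proof. exact: powR_ge0. Qed.

Lemma cbrtK x : 0 <= x -> cbrt x ^+ 3 = x.
Proof.
move=> x0; rewrite /cbrt -powR_mulrn ?powR_ge0// -powRrM mulVf//.
by rewrite powRr1.
Qed.

Lemma ler_cube x y : 0 <= x -> 0 <= y -> (x ^+ 3 <= y ^+ 3) = (x <= y).
Proof. by move=> x0 y0; rewrite ler_pXn2r// nnegrE. Qed.

Lemma le_cbrt x y : 0 <= x -> 0 <= y -> (y <= cbrt x) = (y ^+ 3 <= x).
Proof. by move=> x0 y0; rewrite -ler_cube ?cbrt_ge0// cbrtK. Qed.

Lemma cbrt_gt0 x : 0 < x -> 0 < cbrt x.
Proof. by move=> x0; rewrite powR_gt0. Qed.

(** AM-GM for [x ^ 3], [y ^ 3], [y ^ 3]: the pointwise form of Hölder's inequality below. *)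
Lemma mul_sqr_le_cubes x y : 0 <= x -> 0 <= y ->
  3 * (x * y ^+ 2) <= x ^+ 3 + 2 * y ^+ 3.
Proof.
move=> x0 y0.
have -> : x ^+ 3 + 2 * y ^+ 3 = 3 * (x * y ^+ 2) + (x - y) ^+ 2 * (x + 2 * y).
  by ring.
by rewrite lerDl mulr_ge0 ?sqr_ge0// addr_ge0// mulr_ge0.
Qed.

(* Hölder's inequality with exponents 3 and 3/2, phrased through upper bounds
   for the norms so that no root has to be taken. *)
Lemma holder3 (I : Type) (r : seq I) (P : pred I) (w u v : I -> R) (U V : R) :
  (forall i, P i -> 0 <= w i) -> (forall i, P i -> 0 <= u i) ->
  (forall i, P i -> 0 <= v i) ->
  0 <= U -> 0 <= V ->
  \sum_(i <- r | P i) w i * u i ^+ 3 <= U ^+ 3 ->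
  \sum_(i <- r | P i) w i * v i ^+ 3 <= V ^+ 3 ->
  \sum_(i <- r | P i) w i * (u i * v i ^+ 2) <= U * V ^+ 2.
Proof.
move=> w0 u0 v0 U0 V0 hU hV.
(* This settles the cases [U = 0] and [V = 0], where no normalization is possible. *)
have vanish (F G : I -> R) : (forall i, P i -> 0 <= F i) ->
    (forall i, F i = 0 -> G i = 0) -> \sum_(i <- r | P i) F i <= 0 ->
    \sum_(i <- r | P i) G i = 0.
  move=> F0 FG; elim: (r) => [|i s IH]; first by rewrite !big_nil.
  rewrite !big_cons; case: ifP => // Pi h.
  have := F0 _ Pi; have := sumr_ge0 s F0 => t1 t2.
  by rewrite FG ?IH ?addr0//; lra.
have [U_0|Up] := eqVneq U 0.
  rewrite U_0 mul0r (vanish (fun i => w i * u i ^+ 3))//.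
  - by move=> i Pi; rewrite mulr_ge0 ?w0 ?exprn_ge0 ?u0.
  - by move=> i /eqP; rewrite mulf_eq0 expf_eq0/= -mulf_eq0 mulrA => /eqP->;
      rewrite mul0r.
  - by apply: le_trans hU _; rewrite U_0 expr0n.
have [V_0|Vp] := eqVneq V 0.
  rewrite V_0 expr0n mulr0 (vanish (fun i => w i * v i ^+ 3))//.
  - by move=> i Pi; rewrite mulr_ge0 ?w0 ?exprn_ge0 ?v0.
  - move=> i /eqP; rewrite mulf_eq0 expf_eq0/= => /orP[]/eqP->.
      by rewrite mul0r.
    by rewrite expr0n !mulr0.
  - by apply: le_trans hV _; rewrite V_0 expr0n.
have {Up} Up : 0 < U by rewrite lt0r Up.
have {Vp} Vp : 0 < V by rewrite lt0r Vp.
(* With [u] and [v] scaled by [U] and [V], AM-GM is summed against the weights [w]. *)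
have key : \sum_(i <- r | P i) w i * (3 * ((u i / U) * (v i / V) ^+ 2)) <=
    \sum_(i <- r | P i) w i * ((u i / U) ^+ 3 + 2 * (v i / V) ^+ 3).
  apply: ler_sum => i Pi; apply: ler_wpM2l; first exact: w0.
  by apply: mul_sqr_le_cubes; rewrite divr_ge0 ?u0 ?v0.
have e1 : \sum_(i <- r | P i) w i * (3 * ((u i / U) * (v i / V) ^+ 2)) =
    3 / (U * V ^+ 2) * \sum_(i <- r | P i) w i * (u i * v i ^+ 2).
  rewrite mulr_sumr; apply: eq_bigr => i _; field.
  by rewrite !gt_eqF.
have e2 : \sum_(i <- r | P i) w i * ((u i / U) ^+ 3 + 2 * (v i / V) ^+ 3) =
    (\sum_(i <- r | P i) w i * u i ^+ 3) / U ^+ 3 +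
    2 * ((\sum_(i <- r | P i) w i * v i ^+ 3) / V ^+ 3).
  rewrite !mulr_suml mulr_sumr -big_split; apply: eq_bigr => i _ /=; field.
  by rewrite !gt_eqF.
have b1 : (\sum_(i <- r | P i) w i * u i ^+ 3) / U ^+ 3 <= 1.
  by rewrite ler_pdivrMr ?exprn_gt0// mul1r.
have b2 : (\sum_(i <- r | P i) w i * v i ^+ 3) / V ^+ 3 <= 1.
  by rewrite ler_pdivrMr ?exprn_gt0// mul1r.
have : 3 / (U * V ^+ 2) * \sum_(i <- r | P i) w i * (u i * v i ^+ 2) <= 3.
  rewrite -e1; apply: le_trans key _; rewrite e2; lra.
have UV : 0 < U * V ^+ 2 by rewrite mulr_gt0 ?exprn_gt0.
by rewrite mulrAC ler_pdivrMr// ler_pM2l.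
Qed.

End CubeRoots.

Lemma bernoulli_le {R : numDomainType} (q : R) j :
  0 <= q -> 1 + j%:R * q <= (1 + q) ^+ j.
Proof.
move=> q0; elim: j => [|j IH]; first by rewrite expr0 mul0r addr0.
rewrite exprS mulrDl mul1r -natr1 mulrDl mul1r addrA lerD//.
by rewrite ler_peMr// exprn_ege1// lerDl.
Qed.

(** Otherwise [u] gains a factor above [rho'] at every step from [K] on, while [(rho' / rho) ^ j] is
    unbounded by Bernoulli's inequality. This replaces asymptotics, both for Gaussian sums and for
    lattice point counts. *)
Lemma slow_growth {R : realType} (u : nat -> R) (C rho rho' : R) (K : nat) :
  (forall k, 0 < u k) -> 0 < rho -> rho < rho' ->
  (forall k, u k <= C * rho ^+ k) ->
  exists2 k, (K <= k)%N & u k.+1 <= rho' * u k.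
Proof.
move=> u0 r0 rr hu; apply: contrapT => H.
have gr k : (K <= k)%N -> rho' * u k < u k.+1.
  by move=> Kk; rewrite ltNge; apply/negP => h; apply: H; exists k.
have r0' : 0 < rho' by apply: lt_trans rr.
have low j : rho' ^+ j * u K <= u (K + j)%N.
  elim: j => [|j IH]; first by rewrite expr0 mul1r addn0.
  rewrite exprS addnS -mulrA; apply: le_trans (ltW (gr _ (leq_addr _ _))).
  by rewrite ler_pM2l.
set q := rho' / rho - 1.
have q0 : 0 < q by rewrite subr_gt0 ltr_pdivlMr// mul1r.
have up j : j%:R * q * u K <= C * rho ^+ K.
  have h : rho' ^+ j * u K <= C * rho ^+ K * rho ^+ j.
    by apply: le_trans (low j) _; apply: le_trans (hu _) _; rewrite exprD mulrA.
  have e : rho' = (1 + q) * rho by rewrite /q addrC subrK divfK// gt_eqF.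
  rewrite e exprMn mulrAC ler_pM2r ?exprn_gt0// in h.
  apply: le_trans h; rewrite ler_pM2r//.
  apply: le_trans (bernoulli_le _ (ltW q0)).
  by rewrite lerDr ler01.
have := up (Num.trunc (C * rho ^+ K / (q * u K))).+1.
rewrite -mulrA -ler_pdivlMr ?mulr_gt0// => h.
by have := truncnS_gt (C * rho ^+ K / (q * u K)); rewrite ltNge h.
Qed.

(** Greedy proof of Turán's bound: a vertex of least degree is kept, its neighbours are discarded,
    and induction treats the rest. Loops count, so the vertex is among its own neighbours. *)
Lemma independent_subset {T : eqType} (r : rel T) (V : seq T) :
  symmetric r -> (forall x, x \in V -> r x x) -> uniq V ->
  exists S : seq T, [/\ uniq S, {subset S <= V},
    (forall x y, x \in S -> y \in S -> x != y -> ~~ r x y) &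
    (size V ^ 2 <= size S * \sum_(x <- V) \sum_(y <- V) r x y)%N].
Proof.
move=> rs; have [n] := ubnP (size V); elim: n V => // n IH V sV rV uV.
case: V sV rV uV => [|x0 V0]; first by exists [::].
set V := x0 :: V0 => sV rV uV.
pose deg x := (\sum_(y <- V) r x y)%N.
have [x xV xmin] : exists2 x, x \in V & forall y, y \in V -> (deg x <= deg y)%N.
  have ex : exists k, has (fun x => deg x == k) V.
    by exists (deg x0); rewrite /= eqxx.
  have [k /hasP[x xV /eqP <-] kmin] := ex_minnP ex; exists x => // y yV.
  by apply: kmin; apply/hasP; exists y.
pose V' := [seq y <- V | ~~ r x y].
have degE z : deg z = count (r z) V.
  rewrite /deg -sum1_count [RHS]big_mkcond; apply: eq_bigr => y _.
  by case: (r z y).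
have szE : size V = (size V' + deg x)%N.
  by rewrite degE size_filter addnC -(count_predC (r x) V).
have dx : (0 < deg x)%N.
  by rewrite degE -has_count; apply/hasP; exists x => //; apply: rV.
have [] := IH V'.
- by move: sV; rewrite szE; lia.
- by move=> y; rewrite mem_filter => /andP[_ /rV].
- exact: filter_uniq.
move=> S [uS SV' Sind hS].
exists (x :: S); split.
- rewrite /= uS andbT; apply/negP => /SV'; rewrite mem_filter => /andP[/negP].
  by move=> h _; apply: h; apply: rV.
- move=> y; rewrite inE => /orP[/eqP->//|/SV']; by rewrite mem_filter => /andP[].
- move=> y z; rewrite !inE => /orP[/eqP->|yS] /orP[/eqP->|zS].
  + by rewrite eqxx.
  + by move: (SV' _ zS); rewrite mem_filter => /andP[].
  + by move: (SV' _ yS); rewrite mem_filter rs => /andP[].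
  + exact: Sind.
(* Each of the [deg x] discarded vertices has degree at least [deg x]. *)
have TE : (\sum_(y <- V') \sum_(z <- V') r y z + deg x * deg x <=
    \sum_(y <- V) \sum_(z <- V) r y z)%N.
  rewrite [leqRHS](bigID (fun y => r x y))/= addnC leq_add//.
    rewrite -[X in (X * _)%N]/(deg x) {1}degE mulnC -iter_addn_0.
    rewrite -(big_const_seq _ addn) big_seq_cond [leqRHS]big_seq_cond.
    by apply: leq_sum => y /andP[/xmin].
  rewrite big_filter; apply: leq_sum => y _.
  rewrite big_filter big_mkcond; apply: leq_sum => z _.
  by case: ifP.
rewrite szE; set N := size V' in hS *; set D := deg x in TE *.
set T' := (\sum_(y <- V') \sum_(z <- V') r y z)%N in hS TE.
apply: leq_trans (leq_mul (leqnn _) TE); rewrite /=.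
set m := size S in hS *.
(* AM-GM for [m D ^ 2] and [T'], whose product is at least [(D N) ^ 2] by induction; it supplies the
   cross term of [(N + D) ^ 2]. *)
have h : (2 * (D * N) <= m * D ^ 2 + T')%N.
  rewrite -leq_sqr; apply: leq_trans (nat_AGM2 _ _).
  have : (D ^ 2 * N ^ 2 <= D ^ 2 * (m * T'))%N by rewrite leq_mul2l hS orbT.
  by rewrite !expnMn; lia.
by move: hS h; rewrite -!mulnn; nia.
Qed.

(** * Discrete Gaussians *)

Section DiscreteGaussian.
Context {R : realType}.
Implicit Types (l : R) (m n k : nat).

(** A truncated theta series: the sum of [exp (- l t ^ 2)] over integers [|t| <= m], folded by
    symmetry. *)
Definition gauss_sum l m : R :=
  1 + 2 * \sum_(0 <= t < m) expR (- (l * t.+1%:R ^+ 2)).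

Lemma gauss_sumE l m :
  \sum_(0 <= t < (2 * m).+1) expR (- (l * (t%:R - m%:R) ^+ 2)) = gauss_sum l m.
Proof.
elim: m => [|m IH].
  by rewrite muln0 big_nat1 /gauss_sum big_geq// subrr expr0n mulr0 oppr0 expR0
    mulr0 addr0.
rewrite mulnS big_nat_recl// big_nat_recr//=.
have -> : \sum_(0 <= t < (2 * m).+1) expR (- (l * (t.+1%:R - m.+1%:R) ^+ 2)) =
    gauss_sum l m.
  by rewrite -IH; apply: eq_bigr => t _; rewrite -!natr1 opprD addrACA subrr addr0.
have -> : ((2 * m).+2%:R - m.+1%:R) = m.+1%:R :> R.
  by rewrite -natrB; [congr (_%:R); lia | lia].
by rewrite sub0r sqrrN /gauss_sum big_nat_recr//=; ring.
Qed.

Lemma gauss_sum_ge1 l m : 1 <= gauss_sum l m.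
Proof. by rewrite lerDl mulr_ge0// sumr_ge0// => t _; rewrite expR_ge0. Qed.

Lemma gauss_sum_le l l' m m' : l' <= l -> (m <= m')%N ->
  gauss_sum l m <= gauss_sum l' m'.
Proof.
move=> ll mm; rewrite lerD2l ler_pM2l//.
apply: (@le_trans _ _ (\sum_(0 <= t < m) expR (- (l' * t.+1%:R ^+ 2)))).
  apply: ler_sum => t _; rewrite ler_expR lerN2.
  by rewrite ler_wpM2r// exprn_ge0.
rewrite (big_cat_nat (n := m) _ mm)//= lerDl; apply: sumr_ge0 => t _.
exact: expR_ge0.
Qed.

Lemma gauss_sum_tail l n j : 0 <= l ->
  gauss_sum l (n + j) <= gauss_sum l n + 2 * j%:R * expR (- (l * n%:R ^+ 2)).
Proof.
move=> l0; rewrite /gauss_sum (big_cat_nat (n := n) _ (leq_addr _ _))//=.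
rewrite mulrDr addrA lerD2l -mulrA ler_pM2l//.
rewrite -{1}(add0n n) (addnC n) big_addn addnK.
apply: (@le_trans _ _ (\sum_(0 <= t < j) expR (- (l * n%:R ^+ 2)))).
  apply: ler_sum => t _; rewrite ler_expR lerN2 ler_wpM2l// lerXn2r ?nnegrE//.
  by rewrite ler_nat; lia.
by rewrite sumr_const_nat subn0 mulr_natl.
Qed.

(** As [y ^ 2 >= y - 1], the terms are at most [e] times those of a geometric series, which is
    bounded by telescoping through [1 + x <= exp x]. *)
Lemma gauss_sum_ub (x : R) m : 0 < x ->
  gauss_sum (x ^+ 2) m <= 1 + 2 * expR 1 / x.
Proof.
move=> x0; rewrite lerD2l -mulrA ler_pM2l//.
have step t : expR (- (x ^+ 2 * t.+1%:R ^+ 2)) <=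
    expR 1 / x * (expR (- (x * t%:R)) - expR (- (x * t.+1%:R))).
  apply: (@le_trans _ _ (expR 1 * expR (- (x * t.+1%:R)))).
    rewrite -expRD ler_expR -exprMn; set y := x * _.
    by have := sqr_ge0 (y - 1); have := sqr_ge0 y; nra.
  rewrite -mulrA ler_pM2l ?expR_gt0// ler_pdivlMl//.
  have -> : expR (- (x * t%:R)) = expR x * expR (- (x * t.+1%:R)).
    by rewrite -expRD; congr expR; rewrite -natr1; ring.
  have := expR_ge1Dx x; have := expR_gt0 (- (x * t.+1%:R)); nra.
apply: le_trans (ler_sum _ (fun t _ => step t)) _.
rewrite -mulr_sumr ler_piMr ?divr_ge0 ?expR_ge0 ?(ltW x0)//.
rewrite -[leLHS]opprK -sumrN (eq_bigr (fun t =>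
  expR (- (x * t.+1%:R)) - expR (- (x * t%:R)))); last first.
  by move=> t _; rewrite opprB.
rewrite telescope_sumr// mulr0 oppr0 expR0 opprB.
by have := expR_ge0 (- (x * m%:R)); lra.
Qed.

Lemma gauss_sum_lb l m : l * m%:R ^+ 2 <= 1 -> 0 <= l ->
  m%:R / expR 1 <= gauss_sum l m.
Proof.
move=> lm l0.
have h : m%:R / expR 1 <= \sum_(0 <= t < m) expR (- (l * t.+1%:R ^+ 2)).
  rewrite -expRN mulr_natl -[X in _ *+ X]subn0 -sumr_const_nat.
  rewrite big_nat_cond [leRHS]big_nat_cond; apply: ler_sum => t /andP[/andP[_ tm] _].
  rewrite ler_expR lerN2; apply: le_trans lm; rewrite ler_wpM2l//.
  by rewrite lerXn2r ?nnegrE// ler_nat.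
have : 0 <= m%:R / expR 1 :> R by rewrite divr_ge0 ?expR_ge0.
by rewrite /gauss_sum; lra.
Qed.

(* A unimodal sequence has almost the same sum along the two parity classes:
   the differences [f t - f t.+1] are bounded by those of the nonincreasing
   sequence [fun t => f (maxn t p)], which telescope. *)
Lemma unimodal_parity (f : nat -> R) p N c :
  (forall t, (t < p)%N -> f t <= f t.+1) ->
  (forall t, (p <= t)%N -> f t.+1 <= f t) ->
  (forall t, 0 <= f t <= 1) ->
  2 * (\sum_(0 <= j < N) f (2 * j + c)%N) <=
    \sum_(c <= t < c + 2 * N) f t + 1.
Proof.
move=> fup fdn f01; pose d t := f (maxn t p).
have dd t : f t - f t.+1 <= d t - d t.+1.
  rewrite /d; case: (ltnP t p) => tp.
    have e2 : maxn t.+1 p = p by lia.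
    by rewrite e2 subrr subr_le0 fup.
  have e2 : maxn t.+1 p = t.+1 by lia.
  by rewrite e2.
have dn t : d t.+1 <= d t.
  rewrite /d; case: (ltnP t p) => tp.
    have e2 : maxn t.+1 p = p by lia.
    by rewrite e2.
  have e2 : maxn t.+1 p = t.+1 by lia.
  by rewrite e2 fdn.
suff h : 2 * (\sum_(0 <= j < N) f (2 * j + c)%N) <=
    \sum_(c <= t < c + 2 * N) f t + d c - d (c + 2 * N)%N.
  apply: le_trans h _; have /andP[_] := f01 (maxn c p).
  have /andP[+ _] := f01 (maxn (c + 2 * N) p); rewrite -/(d c) -/(d _); lra.
elim: N => [|N IH]; first by rewrite muln0 addn0 !big_geq// mulr0 add0r subrr.
rewrite big_nat_recr//= mulnS addnCA big_nat_recr/=; last by lia.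
rewrite big_nat_recr/=; last by lia.
rewrite (addnC (2 * N)%N c); move: IH.
have := dd (c + 2 * N)%N; have := dn (c + 2 * N).+1; rewrite !addSn add0n.
lra.
Qed.

(** The weights [g ^ 3] form a discrete Gaussian centred at [n], with [A = 2 n + 1]. Since [2 ((a -
    n) ^ 2 + (b - n) ^ 2) = (a - b) ^ 2 + (a + b - 2 n) ^ 2], the diagonal [a - b = s - A]
    contributes a Gaussian factor in [s - A] times one parity class of a Gaussian sum, about half of
    it. Taking cube roots triples the variance, so summing [E] brings in the factor [sqrt 3]. *)
Lemma gauss_weights (eta theta : R) : 0 < eta -> eta <= 1 -> 0 < theta ->
  exists A (g E : nat -> R), [/\ forall a, 0 < g a,
    \sum_(0 <= a < A) g a ^+ 3 = 1,
    forall a, g a ^+ 3 <= theta,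
    forall s, 0 <= E s &
    (forall s, (s < 2 * A)%N -> \sum_(0 <= b < A | (A <= b + s < 2 * A)%N)
       (g (b + s - A)%N * g b) ^+ 6 <= E s ^+ 3) /\
    \sum_(0 <= s < 2 * A) E s <= cbrt 4 * (Num.sqrt 3 / 2 * (1 + eta))].
Proof.
move=> e0 e1 th0; pose e := eta / 2.
pose w : R := Num.sqrt 3.
have w2 : w ^+ 2 = 3 by rewrite sqr_sqrtr.
have w0 : 0 < w by rewrite sqrtr_gt0.
(* The truncation [4 ^ k] exceeds the width [3 ^ (k / 2)] enough for the tails to
   stay bounded; [u] grows like [sqrt 3 ^ k], so [slow_growth] applies. *)
pose u k := gauss_sum (3^-1 ^+ k) (4 ^ k).
have u_gt0 k : 0 < u k by apply: lt_le_trans (gauss_sum_ge1 _ _).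
have uub k : u k <= (1 + 2 * expR 1) * w ^+ k.
  have wk : 0 < w ^-1 ^+ k by rewrite exprn_gt0// invr_gt0.
  have -> : u k = gauss_sum ((w^-1 ^+ k) ^+ 2) (4 ^ k).
    by rewrite /u -w2 -exprVn -!exprM mulnC.
  apply: le_trans (gauss_sum_ub _ wk) _.
  rewrite exprVn invrK [leRHS]mulrDl mul1r lerD2r exprn_ege1//.
  by rewrite -[1]sqrtr1 ler_wsqrtr// ler1n.
(* The first term makes 10 negligible against [S], the second makes the weights at most [theta]. *)
pose Y : R := 10 / e + theta^-1.
have ee : 0 < e by rewrite divr_gt0.
have [K hK] : exists K, forall k, (K <= k)%N -> Y <= u k.
  pose m := (Num.trunc (Y * expR 1)).+1; exists (m ^ 2)%N => k mk.
  have mY : Y <= m%:R / expR 1.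
    by rewrite ler_pdivlMr ?expR_gt0// ltW// truncnS_gt.
  apply: le_trans mY _.
  have m3 : (m ^ 2 <= 3 ^ k)%N by apply: leq_trans mk _; rewrite ltnW// ltn_expl.
  have m4 : (m <= 4 ^ k)%N.
    apply: (@leq_trans (m ^ 2)); first by rewrite -mulnn; nia.
    by apply: leq_trans mk _; rewrite ltnW// ltn_expl.
  apply: le_trans (gauss_sum_le (lexx _) m4).
  apply: gauss_sum_lb; last by rewrite exprn_ge0// invr_ge0.
  by rewrite exprVn mulrC ler_pdivrMr ?exprn_gt0// mul1r -!natrX ler_nat.
have [||k Kk hk] := @slow_growth R u (1 + 2 * expR 1) w (w * (1 + e)) K u_gt0 w0.
- by rewrite ltr_pMr// ltrDl.
- exact: uub.
have [n nE] : exists n, n = (4 ^ k)%N by exists (4 ^ k)%N.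
have n_gt0 : (0 < n)%N by rewrite nE expn_gt0.
pose l : R := 3^-1 ^+ k; pose A := (2 * n).+1.
have ukE : u k = gauss_sum l n by rewrite nE.
(* The cube of [q] is to bound a parity class: half of [S + 10], where 8 pays for the tails, 1 for
   an extra end term and 1 for the parity error. *)
pose S := u k; pose sg := cbrt S; pose q := cbrt ((S + 10) / 2).
have S0 : 0 < S by exact: u_gt0.
have sg0 : 0 < sg by rewrite cbrt_gt0.
have sg3 : sg ^+ 3 = S by rewrite cbrtK// ltW.
have q3 : q ^+ 3 = (S + 10) / 2 by rewrite cbrtK//; move: S0; lra.
have l0 : 0 < l by rewrite exprn_gt0// invr_gt0.
have SY : Y <= S by exact: hK.
have Se : S + 10 <= (1 + e) * S.
  have h : 10 / e <= S.
    by apply: le_trans SY; rewrite lerDl invr_ge0 ltW.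
  by rewrite ler_pdivrMr// in h; lra.
have Sth : S^-1 <= theta.
  rewrite invf_ple ?posrE//; apply: le_trans SY; rewrite lerDr divr_ge0//.
  exact: ltW.
(* As [l n = (4 / 3) ^ k >= 1], each tail term is at most [1 / n], and there are at most [8 n] of
   them. *)
have tail : gauss_sum l (4 * n).+1 <= S + 8.
  have -> : (4 * n).+1 = (n + (3 * n).+1)%N by clear; lia.
  apply: le_trans (gauss_sum_tail _ _ (ltW l0)) _; rewrite -ukE lerD2l.
  have n0 : 0 < n%:R :> R by rewrite ltr0n.
  have ln : 1 <= l * n%:R.
    by rewrite /l nE natrX -exprMn exprn_ege1// mulrC ler_pdivlMr// mul1r ler_nat.
  have h1 : expR (- (l * n%:R ^+ 2)) <= n%:R^-1.
    rewrite expRN lef_pV2 ?posrE ?expR_gt0//.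
    have := expR_ge1Dx (l * n%:R ^+ 2).
    have : n%:R <= l * n%:R ^+ 2 by rewrite expr2 mulrA ler_peMl// ltW.
    lra.
  have h2 : (3 * n).+1%:R <= 4 * n%:R :> R.
    by rewrite -natrM ler_nat; clear -n_gt0; lia.
  apply: (@le_trans _ _ (2 * (4 * n%:R) * n%:R^-1)).
    by rewrite ler_pM ?mulr_ge0 ?expR_ge0// ler_pM2l.
  by rewrite mulrA mulfK ?gt_eqF//; lra.
pose g (a : nat) := expR (- (l * (a%:R - n%:R) ^+ 2) / 3) / sg.
pose E (s : nat) := expR (- (l * (s%:R - A%:R) ^+ 2) / 3) * q / sg ^+ 4.
have cube (x : R) : expR (x / 3) ^+ 3 = expR x.
  by rewrite -expRM_natr divfK.
have g3 a : g a ^+ 3 = expR (- (l * (a%:R - n%:R) ^+ 2)) / S.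
  by rewrite /g expr_div_n cube sg3.
have p6 (x y : R) : (x * y) ^+ 6 = (x ^+ 3 * y ^+ 3) ^+ 2 by ring.
exists A, g, E; split.
- by move=> a; rewrite divr_gt0 ?expR_gt0.
- under eq_bigr do rewrite g3.
  by rewrite -mulr_suml gauss_sumE -ukE divff// gt_eqF.
- move=> a; rewrite g3; apply: le_trans Sth; rewrite ler_piMl ?invr_ge0 ?(ltW S0)//.
  by rewrite -expR0 ler_expR oppr_le0 mulr_ge0 ?sqr_ge0// ltW.
- by move=> s; rewrite divr_ge0 ?exprn_ge0 ?mulr_ge0 ?expR_ge0 ?cbrt_ge0 ?(ltW sg0).
split.
- move=> s sA.
  pose h (t : nat) := expR (- (l * (t%:R - (4 * n).+1%:R) ^+ 2)).
  have h01 t : 0 <= h t <= 1.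
    rewrite expR_ge0 -expR0 ler_expR oppr_le0 mulr_ge0 ?sqr_ge0//.
    exact: ltW.
  have E3 : E s ^+ 3 = expR (- (l * (s%:R - A%:R) ^+ 2)) / S ^+ 4 * q ^+ 3.
    by rewrite /E expr_div_n exprMn cube -exprM mulnC exprM sg3 mulrAC.
  apply: (@le_trans _ _ (\sum_(0 <= b < A)
      expR (- (l * (s%:R - A%:R) ^+ 2)) / S ^+ 4 * h (2 * b + s)%N)).
    rewrite big_mkcond/= ; apply: ler_sum => b _; case: ifP => [bs|_]; last first.
      by rewrite mulr_ge0 ?divr_ge0 ?expR_ge0 ?exprn_ge0// ltW.
    rewrite p6 !g3 mulf_div -expRD expr_div_n -expRM_natr.
    rewrite mulrAC /h -expRD -expr2 -exprM.
    rewrite le_eqVlt; apply/orP; left; apply/eqP; congr (expR _ / _).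
    rewrite natrB; last by clear -bs; lia.
    by rewrite /A -!natr1 !natrM !natrD ?natrM; ring.
  rewrite -mulr_sumr E3 ler_wpM2l ?divr_ge0 ?expR_ge0 ?exprn_ge0 ?(ltW S0)//.
  rewrite q3 ler_pdivlMr// mulrC.
  have hup t : (t < (4 * n).+1)%N -> h t <= h t.+1.
    move=> ht; rewrite ler_expR lerN2 ler_pM2l//.
    have : t.+1%:R <= (4 * n).+1%:R :> R by rewrite ler_nat.
    by rewrite -(natr1 t); set x := t%:R; set y := _%:R; nra.
  have hdn t : ((4 * n).+1 <= t)%N -> h t.+1 <= h t.
    move=> ht; rewrite ler_expR lerN2 ler_pM2l//.
    have : (4 * n).+1%:R <= t%:R :> R by rewrite ler_nat.
    by rewrite -(natr1 t); set x := t%:R; set y := _%:R; nra.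
  apply: le_trans (unimodal_parity A s hup hdn h01) _.
  have h1 : \sum_(s <= t < s + 2 * A) h t <= \sum_(0 <= t < (2 * (4 * n).+1).+2) h t.
    rewrite [leRHS](big_cat_nat (n := s))//=; last by rewrite /A in sA; clear -sA; lia.
    rewrite [X in _ + X](big_cat_nat (n := (s + 2 * A)%N))/=; last 2 first.
    - by rewrite leq_addr.
    - by rewrite /A in sA *; clear -sA; lia.
    rewrite addrCA lerDl addr_ge0// sumr_ge0// => t _;
      by have /andP[] := h01 t.
  rewrite big_nat_recr//= gauss_sumE in h1.
  by have /andP[_] := h01 (2 * (4 * n).+1).+1; lra.
- rewrite /E -mulr_suml -mulr_suml.
  have h1 : \sum_(0 <= s < 2 * A) expR (- (l * (s%:R - A%:R) ^+ 2) / 3) <= u k.+1.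
    apply: (@le_trans _ _ (\sum_(0 <= s < (2 * A).+1)
        expR (- (l / 3 * (s%:R - A%:R) ^+ 2)))).
      rewrite [leRHS]big_nat_recr//= -[leLHS]addr0 lerD ?expR_ge0//.
      by apply: ler_sum => s _; rewrite mulNr mulrAC.
    rewrite gauss_sumE; apply: gauss_sum_le; first by rewrite exprS mulrC.
    by rewrite expnS -nE /A; clear -n_gt0; lia.
  (* After cubing and [S + 10 <= (1 + e) S] this becomes [(1 + e) ^ 4 <= (1 + 2 e) ^ 3], whence the
     choice [e = eta / 2]. *)
  have h2 : 2 * ((1 + e) * q) <= cbrt 4 * ((1 + eta) * sg).
    rewrite -ler_cube ?mulr_ge0 ?cbrt_ge0 ?addr_ge0 ?(ltW ee) ?(ltW e0)//.
    rewrite !exprMn q3 sg3 cbrtK//.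
    apply: (@le_trans _ _ (4 * ((1 + e) ^+ 3 * ((1 + e) * S)))).
      have : 0 <= (1 + e) ^+ 3 by rewrite exprn_ge0// addr_ge0// ltW.
      by move: Se; nra.
    rewrite ler_pM2l// mulrA ler_pM2r// -exprSr.
    have -> : eta = 2 * e by rewrite /e mulrC divfK.
    have : e <= 1 by rewrite /e; lra.
    have e2 := sqr_ge0 e; have e3 : 0 <= e ^+ 3 by rewrite exprn_ge0// ltW.
    by nra.
  rewrite ler_pdivrMr ?exprn_gt0//.
  apply: (@le_trans _ _ (w * (1 + e) * S * q)).
    by rewrite ler_wpM2r ?cbrt_ge0//; apply: le_trans h1 hk.
  have -> : w * (1 + e) * S * q = (w / 2 * S) * (2 * ((1 + e) * q)).
    by field.
  have -> : cbrt 4 * (Num.sqrt 3 / 2 * (1 + eta)) * sg ^+ 4 =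
    (w / 2 * S) * (cbrt 4 * ((1 + eta) * sg)).
    by rewrite -sg3 -/w; ring.
  by rewrite ler_wpM2l// mulr_ge0 ?divr_ge0 ?(ltW S0) ?(ltW w0).
Qed.

End DiscreteGaussian.

(** * Quantiles of a step density *)

Section Quantiles.
Context {R : realType}.
Implicit Types (x y : R) (i M : nat).

(* The length of the part of the cell [[i, i + 1]] lying to the left of [x]. *)
Definition clamp i x : R := Num.min (Num.max (x - i%:R) 0) 1.

Lemma clampP i x : [\/ x <= i%:R /\ clamp i x = 0,
  i%:R <= x <= i%:R + 1 /\ clamp i x = x - i%:R |
  i%:R + 1 <= x /\ clamp i x = 1].
Proof.
rewrite /clamp; have [h|h] := leP (x - i%:R) 0.
  by rewrite min_l ?ler01//; constructor 1; split => //; lra.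
have [h'|h'] := leP (x - i%:R) 1; first by constructor 2; split => //; lra.
by constructor 3; split => //; lra.
Qed.

Lemma clamp_le i x y : x <= y -> clamp i x <= clamp i y.
Proof.
by move=> xy; case: (clampP i x) => -[? ->]; case: (clampP i y) => -[? ->]; lra.
Qed.

Lemma clamp_bound i x : 0 <= clamp i x <= 1.
Proof. by case: (clampP i x) => -[? ->]; lra. Qed.

Lemma clamp_sum M x : 0 <= x <= M%:R -> \sum_(0 <= i < M) clamp i x = x.
Proof.
suff h : 0 <= x -> \sum_(0 <= i < M) clamp i x = Num.min x M%:R.
  by move=> /andP[x0 xM]; rewrite h// min_l.
move=> x0; elim: M => [|M IH]; first by rewrite big_geq// min_r.
rewrite big_nat_recr//= IH -natr1.
case: (clampP M x) => -[h ->].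
- by rewrite !min_l ?addr0//; lra.
- by rewrite min_r ?min_l; lra.
- by rewrite !min_r; lra.
Qed.

Lemma clamp_continuous i : continuous (clamp i).
Proof.
move=> x; apply: (@continuous_min R R (fun y => Num.max (y - i%:R) 0) (fun=> 1)).
  apply: (@continuous_max R R (fun y => y - i%:R) (fun=> 0)).
    by apply: continuousB; [exact: cvg_id | exact: cvg_cst].
  exact: cvg_cst.
exact: cvg_cst.
Qed.

(* Cuts [[0, M]] into consecutive intervals of prescribed masses with respect
   to the density equal to [m i] on [[i, i + 1]]. *)
Lemma quantiles M (m : nat -> R) A (gam : nat -> R) (theta : R) :
  0 < theta -> (forall i, (i < M)%N -> theta <= m i) ->
  \sum_(0 <= i < M) m i = 1 ->
  (forall a, 0 < gam a <= theta) -> \sum_(0 <= a < A) gam a = 1 ->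
  exists x : nat -> R,
    [/\ forall a, 0 <= x a <= M%:R,
        forall a, x a <= x a.+1,
        forall a, (a < A)%N -> x a < x a.+1 <= x a + 1,
        forall i, (i < M)%N -> clamp i (x 0) = 0 /\ clamp i (x A) = 1 &
        forall a, (a < A)%N ->
          \sum_(0 <= i < M) (clamp i (x a.+1) - clamp i (x a)) * m i = gam a].
Proof.
move=> th0 mth m1 gam0 gam1.
(* The cumulative distribution function; the cuts come from the intermediate value theorem. *)
pose F x := \sum_(0 <= i < M) clamp i x * m i.
have m_ge0 i : (i < M)%N -> 0 <= m i.
  by move=> iM; apply: le_trans (ltW th0) (mth _ iM).
have Fc : continuous F.
  rewrite /F; elim: (M) => [|N IH] x.
    rewrite (_ : (fun x => _) = fun=> 0); first exact: cvg_cst.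
    by apply/funext => y; rewrite big_geq.
  rewrite (_ : (fun x => _) =
      (fun x => \sum_(0 <= i < N) clamp i x * m i) \+ (fun x => clamp N x * m N)).
    apply: continuousD; first exact: IH.
    by apply: continuousM; [exact: clamp_continuous | exact: cvg_cst].
  by apply/funext => y; rewrite big_nat_recr.
have F0 : F 0 = 0.
  rewrite /F big_nat_cond big1// => i /andP[/andP[_ iM] _].
  case: (clampP i (0 : R)) => -[h ->]; rewrite ?mul0r//.
    by have : 0 <= i%:R :> R by []; rewrite sub0r => ?; rewrite (_ : i%:R = 0) ?oppr0 ?mul0r//; lra.
  by have : 0 <= i%:R :> R by []; lra.
have FM : F M%:R = 1.
  rewrite -[RHS]m1 /F; apply: eq_big_nat => i /andP[_ iM].
  have : i.+1%:R <= M%:R :> R by rewrite ler_nat.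
  rewrite -natr1 => h.
  case: (clampP i (M%:R : R)) => -[h' ->]; rewrite ?mul1r//; first by lra.
  by rewrite (_ : M%:R - i%:R = 1) ?mul1r//; lra.
pose Gam a := \sum_(0 <= j < minn a A) gam j.
have Gam01 a : 0 <= Gam a <= 1.
  rewrite sumr_ge0/=; last by move=> j _; have /andP[/ltW] := gam0 j.
  rewrite -gam1 [leRHS](big_cat_nat (n := minn a A))//= ?geq_minr//.
  by rewrite lerDl sumr_ge0// => j _; have /andP[/ltW] := gam0 j.
have ex a : exists x, 0 <= x <= M%:R /\ F x = Gam a.
  have [||x xM Fx] := @IVT R F 0 M%:R (Gam a) (ler0n _ _).
  - exact: continuous_subspaceT.
  - by rewrite F0 FM min_l ?max_r ?ler01.
  - by exists x; split => //; rewrite in_itv/= in xM.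
pose y a := sval (cid (ex a)).
have yM a : 0 <= y a <= M%:R by have [] := svalP (cid (ex a)).
have yF a : F (y a) = Gam a by have [] := svalP (cid (ex a)).
(* Freezing the sequence from [A] on makes monotonicity hold for every index. *)
pose x a := y (minn a A).
have xF a : F (x a) = Gam a by rewrite yF /Gam -minnA minnn.
have F_le u v : u <= v -> F u <= F v.
  move=> uv; rewrite /F big_nat_cond [leRHS]big_nat_cond; apply: ler_sum.
  by move=> i /andP[/andP[_ iM] _]; rewrite ler_wpM2r ?m_ge0// clamp_le.
have GamS a : (a < A)%N -> Gam a.+1 = Gam a + gam a.
  move=> aA; rewrite /Gam (minn_idPl aA) (minn_idPl (ltnW aA)).
  by rewrite big_nat_recr.
have x_lt a : (a < A)%N -> x a < x a.+1.
  move=> aA; rewrite ltNge; apply/negP => /F_le; rewrite !xF GamS//.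
  by have /andP[] := gam0 a; lra.
have x_le a : x a <= x a.+1.
  have [aA|aA] := ltnP a A; first exact/ltW/x_lt.
  by rewrite /x (minn_idPr aA) (minn_idPr (leqW aA)).
have xM a : 0 <= x a <= M%:R by exact: yM.
have mass a : (a < A)%N ->
    \sum_(0 <= i < M) (clamp i (x a.+1) - clamp i (x a)) * m i = gam a.
  move=> aA; under eq_bigr do rewrite mulrBl.
  rewrite big_split/= sumrN -[X in X - _]/(F _) -[X in _ - X]/(F _) !xF GamS//.
  by rewrite addrC addKr.
exists x; split => //.
- move=> a aA; rewrite x_lt//=.
  (* Density at least [theta] and mass at most [theta] force length at most 1. *)
  have : theta * (x a.+1 - x a) <= gam a.
    have -> : x a.+1 - x a = \sum_(0 <= i < M) (clamp i (x a.+1) - clamp i (x a)).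
      by rewrite sumrB !clamp_sum.
    rewrite -mass// mulr_sumr.
    rewrite big_nat_cond [leRHS]big_nat_cond; apply: ler_sum.
    move=> i /andP[/andP[_ iM] _]; rewrite mulrC ler_wpM2l ?mth//.
    by rewrite subr_ge0 clamp_le.
  by have /andP[_] := gam0 a; have := x_lt _ aA; nra.
- move=> i iM.
  (* The density is positive, so no cell can have a part left of [x 0], where the mass is 0, or
     right of [x A], where it is 1. *)
  have vanish (c : nat -> R) : (forall i, 0 <= c i) ->
      \sum_(0 <= i < M) c i * m i = 0 -> c i = 0.
    move=> c0; rewrite big_mkord => /psumr_eq0P h.
    have : c i * m i = 0.
      apply: (h _ (Ordinal iM)) => // j _; by rewrite mulr_ge0 ?m_ge0.
    move/eqP; rewrite mulf_eq0 => /orP[/eqP//|/eqP mi].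
    by have := mth _ iM; rewrite mi; lra.
  split.
    apply: (vanish (fun i => clamp i (x 0))); first by move=> j; have /andP[] := clamp_bound j (x 0).
    by rewrite -/(F _) xF /Gam min0n big_geq.
  apply/esym/eqP; rewrite -subr_eq0; apply/eqP.
  apply: (vanish (fun i => 1 - clamp i (x A))).
    by move=> j; have := clamp_bound j (x A); lra.
  under eq_bigr do rewrite mulrBl mul1r.
  by rewrite sumrB m1 -/(F _) xF /Gam minnn gam1 subrr.
Qed.

End Quantiles.

(** * The discrete Young inequality *)

(** The diagonal has index [s = a - b + A], with offset [A] to stay natural; the guard on [b + s]
    says [0 <= a < A]. *)
Lemma sum_diagonals {V : zmodType} A (F : nat -> nat -> V) :
  \sum_(0 <= a < A) \sum_(0 <= b < A) F a b =
  \sum_(0 <= s < 2 * A) \sum_(0 <= b < A | (A <= b + s < 2 * A)%N)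
    F (b + s - A)%N b.
Proof.
rewrite exchange_big/= [RHS](exchange_big_dep_nat xpredT)//=.
apply: eq_big_nat => b /andP[_ bA].
have e1 : (2 * A - b - (A - b) = A)%N by lia.
have := @big_addn V 0 +%R 0 (2 * A - b) (A - b) xpredT
  (fun s => F (b + s - A)%N b).
rewrite e1 add0n => h.
transitivity (\sum_(0 <= i < A) F (b + (i + (A - b)) - A)%N b).
  by apply: eq_big_nat => i _; congr F; lia.
rewrite -h (big_nat_widenl _ 0)//= (big_nat_widen _ _ (2 * A))//=; last by lia.
rewrite big_nat_cond [RHS]big_nat_cond.
by apply: eq_bigl => s; lia.
Qed.

Lemma positive_lower_bound {R : realType} (m : nat -> R) M :
  (forall i, 0 < m i) -> exists2 t, 0 < t & forall i, (i < M)%N -> t <= m i.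
Proof.
move=> m0; elim: M => [|M [t t0 tm]]; first by exists 1.
exists (Num.min t (m M)); first by rewrite lt_min t0 m0.
move=> i; rewrite ltnS leq_eqVlt => /orP[/eqP->|/tm h].
  by rewrite ge_min lexx orbT.
by rewrite ge_min h.
Qed.

Section DiscreteYoung.
Context {R : realType}.
Implicit Types (phi psi chi : nat -> R) (kap : nat -> nat -> R).

Let C0 : R := Num.sqrt 3 / 2.

Section Cells.
Variables (M : nat) (x y : nat -> R) (A : nat).
Hypothesis x_bound : forall a, 0 <= x a <= M%:R.
Hypothesis y_bound : forall a, 0 <= y a <= M%:R.
Hypothesis x_le : forall a, x a <= x a.+1.
Hypothesis y_le : forall a, y a <= y a.+1.

(** For monotone [z], the length of the part of [[i, i + 1]] inside [[z a, z (a + 1)]]. *)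
Definition share (z : nat -> R) a i : R := clamp i (z a.+1) - clamp i (z a).

(* The shift by [2] turns the window [i + j - 2 < z < i + j + 4], in which a sum of
   points of cells meeting [[i, i + 1]] and [[j, j + 1]] lies, into one starting
   at [i + j]. *)
Definition sum_share a b k : R :=
  clamp k (x a.+1 + y b.+1 + 2) - clamp k (x a + y b + 2).

Lemma sum_share_ge0 a b k : 0 <= sum_share a b k.
Proof. by rewrite subr_ge0 clamp_le// lerD2r lerD. Qed.

Lemma sum_share_total a b :
  \sum_(0 <= k < 2 * M + 5) sum_share a b k =
  (x a.+1 - x a) + (y b.+1 - y b).
Proof.
have MM : (2 * M + 5)%:R = 2 * M%:R + 5 :> R by rewrite natrD natrM.
have := x_bound a; have := x_bound a.+1; have := y_bound b; have := y_bound b.+1.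
move=> h1 h2 h3 h4; rewrite /sum_share sumrB !clamp_sum ?MM; first by lra.
- by lra.
- by lra.
Qed.

(* Along a diagonal [a - b = const] the intervals
   [[x a + y b, x a.+1 + y b.+1]] are consecutive. *)
Lemma sum_share_diagonal s k :
  \sum_(0 <= b < A | (A <= b + s < 2 * A)%N) sum_share (b + s - A) b k <= 1.
Proof.
pose G b := clamp k (x (b + s - A)%N + y b + 2).
have Gle b : G b <= G b.+1.
  rewrite clamp_le// lerD2r lerD//.
  (* Where [b + s < A], truncated subtraction yields index 0 at both [b] and [b + 1], so [G] stays
     monotone. *)
  have [h|h] := leqP A (b + s); first by rewrite addSn subSn.
  have -> : (b + s - A = 0)%N by lia.
  by have -> : (b.+1 + s - A = 0)%N by lia.
apply: (@le_trans _ _ (\sum_(0 <= b < A) (G b.+1 - G b))).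
  rewrite big_mkcond/=; apply: ler_sum => b _; case: ifP => [/andP[h _]|_].
    by rewrite /G /sum_share addSn subSn.
  by rewrite subr_ge0.
rewrite telescope_sumr//.
have := clamp_bound k (x (A + s - A)%N + y A + 2).
have := clamp_bound k (x (0 + s - A)%N + y 0%N + 2).
by rewrite -/(G A) -/(G 0%N); lra.
Qed.

Lemma share_support (z : nat -> R) a i : z a.+1 <= z a + 1 ->
  0 < share z a i -> i%:R - 1 < z a /\ z a.+1 < i%:R + 2.
Proof.
move=> z1; rewrite /share.
by case: (clampP i (z a)) => -[h ->]; case: (clampP i (z a.+1)) => -[h' ->];
  lra.
Qed.

(** Intervals of length at most 1 meeting cells [i] and [j] have sums which, shifted by 2, lie
    strictly between [i + j] and [i + j + 6]; only six cells [k] meet them. *)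
Lemma sum_share_support a b i j k :
  x a.+1 <= x a + 1 -> y b.+1 <= y b + 1 ->
  0 < share x a i -> 0 < share y b j -> 0 < sum_share a b k ->
  (i + j <= k <= i + j + 5)%N.
Proof.
move=> x1 y1 /(share_support x1) hx /(share_support y1) hy hk.
have hk' : x a + y b + 2 < k%:R + 1 /\ k%:R < x a.+1 + y b.+1 + 2.
  move: hk; rewrite /sum_share.
  by case: (clampP k (x a + y b + 2)) => -[h ->];
    case: (clampP k (x a.+1 + y b.+1 + 2)) => -[h' ->]; lra.
have h1 : (i + j)%:R < k.+1%:R :> R by rewrite natrD -natr1; lra.
have h2 : k%:R < (i + j + 6)%:R :> R by rewrite !natrD; lra.
by move: h1 h2; rewrite !ltr_nat; lia.
Qed.

End Cells.

(** The functions in Young's inequality are [phi ^ 2], [psi ^ 2], [chi ^ 2], so their norms of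
    exponent 3/2 become sums of cubes. The densities [phi ^ 3] and [psi ^ 3] are both transported to
    the weights [g ^ 3]. *)
Lemma young_normalized M phi psi chi kap (c eta : R) :
  0 < eta -> eta <= 1 ->
  (forall i, 0 < phi i) -> (forall j, 0 < psi j) -> (forall k, 0 <= chi k) ->
  (forall i j, 0 <= kap i j) -> 0 <= c ->
  \sum_(0 <= i < M) phi i ^+ 3 = 1 -> \sum_(0 <= j < M) psi j ^+ 3 = 1 ->
  \sum_(0 <= k < 2 * M + 5) chi k ^+ 3 <= c ^+ 3 ->
  (forall i j k, (i < M)%N -> (j < M)%N -> (i + j <= k <= i + j + 5)%N ->
     kap i j <= chi k) ->
  \sum_(0 <= i < M) \sum_(0 <= j < M) phi i ^+ 2 * psi j ^+ 2 * kap i j ^+ 2 <=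
    C0 * (1 + eta) * c ^+ 2.
Proof.
move=> e0 e1 phi0 psi0 chi0 kap0 c0 phi1 psi1 chic kapchi.
have phi3 i : 0 < phi i ^+ 3 by rewrite exprn_gt0.
have psi3 i : 0 < psi i ^+ 3 by rewrite exprn_gt0.
have [t1 t10 t1P] := positive_lower_bound M phi3.
have [t2 t20 t2P] := positive_lower_bound M psi3.
pose th := Num.min t1 t2.
have th0 : 0 < th by rewrite lt_min t10.
have [A [g [E [g0 g1 gth E0 [gE Esum]]]]] := gauss_weights e0 e1 th0.
have gam a : 0 < g a ^+ 3 <= th by rewrite exprn_gt0//= gth.
have [|x [xM xS xA xfull xmass]] := quantiles th0 _ phi1 gam g1.
  by move=> i iM; apply: le_trans (t1P _ iM); rewrite ge_min lexx.
have [|y [yM yS yA yfull ymass]] := quantiles th0 _ psi1 gam g1.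
  by move=> i iM; apply: le_trans (t2P _ iM); rewrite ge_min lexx orbT.
have share_ge0 z a i : (forall a, z a <= z a.+1) -> 0 <= share z a i.
  by move=> zS; rewrite subr_ge0 clamp_le.
(* The mass of [chi ^ 3] on the sum interval of the cell [(a, b)]. *)
pose H a b := \sum_(0 <= k < 2 * M + 5) sum_share x y a b k * chi k ^+ 3.
have H0 a b : 0 <= H a b.
  by apply: sumr_ge0 => k _; rewrite mulr_ge0 ?exprn_ge0 ?sum_share_ge0.
pose h a b := cbrt (H a b).
pose cell a b := \sum_(0 <= i < M) \sum_(0 <= j < M)
  share x a i * share y b j * (phi i ^+ 2 * psi j ^+ 2 * kap i j ^+ 2).
(* Hölder against the constant 1: the integral of [f ^ 2] is at most
   [length ^ (1/3) * mass ^ (2/3)]. *)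
have share_mass (z : nat -> R) (f : nat -> R) a :
    (forall i, 0 < f i) -> (forall a, z a <= z a.+1) ->
    (forall a, 0 <= z a <= M%:R) ->
    \sum_(0 <= i < M) share z a i * f i ^+ 3 = g a ^+ 3 ->
    \sum_(0 <= i < M) share z a i * f i ^+ 2 <= cbrt (z a.+1 - z a) * g a ^+ 2.
  move=> f0 zS zM zmass.
  rewrite (eq_bigr (fun i => share z a i * (1 * f i ^+ 2))); last first.
    by move=> i _; rewrite mul1r.
  apply: holder3 => //.
  - by move=> i _; exact: share_ge0.
  - by move=> i _; exact: ltW.
  - exact: cbrt_ge0.
  - exact: ltW.
  - rewrite cbrtK ?subr_ge0//; under eq_bigr do rewrite expr1n mulr1.
    by rewrite /share sumrB !clamp_sum.
  - by rewrite zmass.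
have cell_le a b : (a < A)%N -> (b < A)%N ->
    cell a b <= (g a * g b) ^+ 2 * h a b ^+ 2 / cbrt 4.
  move=> aA bA; have /andP[xlt x1] := xA _ aA; have /andP[ylt y1] := yA _ bA.
  pose L := cbrt ((x a.+1 - x a) + (y b.+1 - y b)).
  have len0 : 0 < (x a.+1 - x a) + (y b.+1 - y b) by lra.
  have L0 : 0 < L by rewrite cbrt_gt0.
  have L3 : L ^+ 3 = (x a.+1 - x a) + (y b.+1 - y b) by rewrite cbrtK// ltW.
  (* On every cell met by the sum interval [chi] is at least [kap i j], so [H] is at least
     [kap i j ^ 3] times the length [L ^ 3]. *)
  have kapL i j : (i < M)%N -> (j < M)%N -> 0 < share x a i -> 0 < share y b j ->
      kap i j * L <= h a b.
    move=> iM jM hi hj.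
    rewrite le_cbrt ?mulr_ge0 ?(ltW L0)// exprMn L3 -(sum_share_total xM yM).
    rewrite mulr_sumr; apply: ler_sum => k _; rewrite mulrC.
    have := sum_share_ge0 xS yS a b k; rewrite le_eqVlt => /orP[/eqP <-|hk].
      by rewrite !mul0r.
    rewrite ler_pM2l// ler_cube//; apply: kapchi => //.
    exact: (sum_share_support x1 y1 hi hj hk).
  have step : cell a b * L ^+ 2 <=
      (\sum_(0 <= i < M) share x a i * phi i ^+ 2) *
      (\sum_(0 <= j < M) share y b j * psi j ^+ 2) * h a b ^+ 2.
    rewrite /cell !mulr_suml big_nat_cond [leRHS]big_nat_cond.
    apply: ler_sum => i /andP[/andP[_ iM] _].
    rewrite mulr_sumr !mulr_suml big_nat_cond [leRHS]big_nat_cond.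
    apply: ler_sum => j /andP[/andP[_ jM] _].
    have := share_ge0 _ a i xS; rewrite le_eqVlt => /orP[/eqP <-|hi].
      by rewrite !mul0r.
    have := share_ge0 _ b j yS; rewrite le_eqVlt => /orP[/eqP <-|hj].
      by rewrite !(mul0r, mulr0).
    have kL : (kap i j * L) ^+ 2 <= h a b ^+ 2.
      by rewrite lerXn2r ?nnegrE ?mulr_ge0 ?cbrt_ge0 ?(ltW L0)// kapL.
    have w0 : 0 <= share x a i * share y b j * (phi i ^+ 2 * psi j ^+ 2).
      by apply: mulr_ge0; apply: mulr_ge0; rewrite ?sqr_ge0 ?ltW.
    have := ler_wpM2l w0 kL; rewrite exprMn => kL'.
    by apply: le_trans (le_trans _ kL') _; rewrite le_eqVlt; apply/orP; left;
      apply/eqP; ring.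
  (* The cube root of [4 p q <= (p + q) ^ 2] for the two side lengths; this yields the factor
     [1 / cbrt 4]. *)
  have PQ : cbrt 4 * (cbrt (x a.+1 - x a) * cbrt (y b.+1 - y b)) <= L ^+ 2.
    rewrite -ler_cube ?mulr_ge0 ?cbrt_ge0 ?exprn_ge0 ?(ltW L0)//.
    rewrite -exprM mulnC exprM L3 !exprMn !cbrtK ?subr_ge0//.
    by have := sqr_ge0 ((x a.+1 - x a) - (y b.+1 - y b)); lra.
  have s1 := share_mass x phi a phi0 xS xM (xmass _ aA).
  have s2 := share_mass y psi b psi0 yS yM (ymass _ bA).
  have c4 : 0 < cbrt 4 :> R by rewrite cbrt_gt0.
  rewrite ler_pdivlMr// -(ler_pM2r (exprn_gt0 2 L0)).
  have -> : cell a b * cbrt 4 * L ^+ 2 = cbrt 4 * (cell a b * L ^+ 2) by ring.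
  apply: (@le_trans _ _ (cbrt 4 * (cbrt (x a.+1 - x a) * g a ^+ 2 *
      (cbrt (y b.+1 - y b) * g b ^+ 2) * h a b ^+ 2))).
    rewrite ler_pM2l//; apply: le_trans step _; rewrite ler_wpM2r ?sqr_ge0//.
    by apply: ler_pM => //; apply: sumr_ge0 => i _;
      rewrite mulr_ge0 ?sqr_ge0 ?share_ge0.
  have w0 : 0 <= (g a * g b) ^+ 2 * h a b ^+ 2 by rewrite mulr_ge0 ?sqr_ge0.
  have := ler_wpM2l w0 PQ => PQ'.
  by apply: le_trans (le_trans _ PQ') _; rewrite le_eqVlt; apply/orP; left;
    apply/eqP; ring.
(* The shares of each unit cell add up to 1. *)
have split : \sum_(0 <= i < M) \sum_(0 <= j < M)
    phi i ^+ 2 * psi j ^+ 2 * kap i j ^+ 2 =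
    \sum_(0 <= a < A) \sum_(0 <= b < A) cell a b.
  have full (z : nat -> R) i : clamp i (z 0%N) = 0 /\ clamp i (z A) = 1 ->
      \sum_(0 <= a < A) share z a i = 1.
    move=> [zi0 zi1]; rewrite /share.
    by rewrite (telescope_sumr (fun a => clamp i (z a)))// zi0 zi1 subr0.
  rewrite /cell; under [RHS]eq_bigr do rewrite exchange_big/=.
  rewrite [RHS]exchange_big/=; apply: eq_big_nat => i /andP[_ iM].
  under [RHS]eq_bigr do rewrite exchange_big/=.
  rewrite [RHS]exchange_big/=; apply: eq_big_nat => j /andP[_ jM].
  under eq_bigr do rewrite -mulr_suml -mulr_sumr.
  by rewrite -mulr_suml -mulr_suml !full ?mul1r//; [exact: yfull | exact: xfull].
have c4 : 0 < cbrt 4 :> R by rewrite cbrt_gt0.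
rewrite split.
apply: (@le_trans _ _ (\sum_(0 <= a < A) \sum_(0 <= b < A)
    (g a * g b) ^+ 2 * h a b ^+ 2 / cbrt 4)).
  rewrite big_nat_cond [leRHS]big_nat_cond; apply: ler_sum => a /andP[/andP[_ aA] _].
  rewrite big_nat_cond [leRHS]big_nat_cond; apply: ler_sum => b /andP[/andP[_ bA] _].
  exact: cell_le.
rewrite sum_diagonals.
(* Hölder along a diagonal: the cubes of [(g a * g b) ^ 2] sum to at most [E s ^ 3], those of [h] to
   at most [c ^ 3], the sum intervals there being consecutive. *)
apply: (@le_trans _ _ (\sum_(0 <= s < 2 * A) E s * c ^+ 2 / cbrt 4)).
  rewrite big_nat_cond [leRHS]big_nat_cond; apply: ler_sum => s /andP[/andP[_ sA] _].
  rewrite -mulr_suml ler_pM2r ?invr_gt0//.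
  under eq_bigr do rewrite -[_ * _ ^+ 2]mul1r.
  apply: holder3 => //.
  - by move=> b _; rewrite sqr_ge0.
  - by move=> b _; exact: cbrt_ge0.
  - apply: le_trans (gE _ sA); apply: ler_sum => b _.
    by rewrite mul1r -exprM.
  - apply: le_trans chic.
    under eq_bigr do rewrite mul1r cbrtK//.
    rewrite /H exchange_big/=; apply: ler_sum => k _.
    rewrite -mulr_suml ler_piMl ?exprn_ge0//.
    exact: sum_share_diagonal.
rewrite -mulr_suml -mulr_suml ler_pdivrMr//.
have -> : C0 * (1 + eta) * c ^+ 2 * cbrt 4 =
  cbrt 4 * (Num.sqrt 3 / 2 * (1 + eta)) * c ^+ 2 by rewrite /C0; ring.
by rewrite ler_wpM2r ?sqr_ge0.
Qed.

End DiscreteYoung.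

(** * Young's inequality without normalization, on the line and then on boxes *)

Section YoungBox.
Context {R : realType}.

Let C0 : R := Num.sqrt 3 / 2.

Lemma le_of_affine (X S T : R) : 0 <= T ->
  (forall e, 0 < e -> e <= 1 -> X <= S + e * T) -> X <= S.
Proof.
move=> T0 h; rewrite leNgt; apply/negP => SX.
pose e := Num.min 1 ((X - S) / (2 * (T + 1))).
have e0 : 0 < e by rewrite lt_min ltr01 divr_gt0//; lra.
have e1 : e <= 1 by rewrite ge_min lexx.
have e2 : e * (2 * (T + 1)) <= X - S.
  by rewrite -ler_pdivlMr ?ge_min ?lexx ?orbT//; lra.
by have := h _ e0 e1; nra.
Qed.

(** The slack [a ^ 3 - S], spread evenly over the [M] indices, makes all values positive and the
    total exact. *)
Lemma normalize_sum M (f : nat -> R) (a : R) :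
  (0 < M)%N -> (forall i, 0 <= f i) -> 0 < a ->
  \sum_(0 <= i < M) f i ^+ 3 < a ^+ 3 ->
  exists f' : nat -> R, [/\ forall i, 0 < f' i, forall i, f i <= a * f' i &
    \sum_(0 <= i < M) f' i ^+ 3 = 1].
Proof.
move=> M0 f0 a0 fa; set S := bigop _ _ _ in fa.
pose t := (a ^+ 3 - S) / M%:R.
have t0 : 0 < t by rewrite divr_gt0 ?subr_gt0 ?ltr0n.
have ft i : 0 < f i ^+ 3 + t by rewrite ltr_wpDl ?exprn_ge0.
exists (fun i => cbrt (f i ^+ 3 + t) / a); split.
- by move=> i; rewrite divr_gt0 ?cbrt_gt0.
- move=> i; rewrite mulrC divfK ?gt_eqF// le_cbrt ?(ltW (ft i))//.
  by rewrite lerDl ltW.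
- rewrite (eq_bigr (fun i => (f i ^+ 3 + t) / a ^+ 3)); last first.
    by move=> i _; rewrite expr_div_n cbrtK// ltW.
  rewrite -mulr_suml big_split/= sumr_const_nat subn0 -/S.
  rewrite -[t *+ M]mulr_natr /t divfK ?pnatr_eq0 -?lt0n//.
  by rewrite addrC subrK divff// expf_eq0 gt_eqF.
Qed.

(** Enlarging [a] and [b] by [e] gives the strict bounds needed to normalize; the resulting estimate
    is at most affine in [e], and [e] tends to 0. *)
Lemma young_line M (phi psi chi : nat -> R) (kap : nat -> nat -> R) (a b c : R) :
  (forall i, 0 <= phi i) -> (forall j, 0 <= psi j) -> (forall k, 0 <= chi k) ->
  (forall i j, 0 <= kap i j) -> 0 <= a -> 0 <= b -> 0 <= c ->
  \sum_(0 <= i < M) phi i ^+ 3 <= a ^+ 3 ->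
  \sum_(0 <= j < M) psi j ^+ 3 <= b ^+ 3 ->
  \sum_(0 <= k < 2 * M + 5) chi k ^+ 3 <= c ^+ 3 ->
  (forall i j k, (i < M)%N -> (j < M)%N -> (i + j <= k <= i + j + 5)%N ->
     kap i j <= chi k) ->
  \sum_(0 <= i < M) \sum_(0 <= j < M) phi i ^+ 2 * psi j ^+ 2 * kap i j ^+ 2 <=
    C0 * (a * b * c) ^+ 2.
Proof.
move=> phi0 psi0 chi0 kap0 a0 b0 c0 phia psib chic kapchi.
have C00 : 0 <= C0 by rewrite divr_ge0.
have [M0|M0] := posnP M.
  by rewrite M0 big_geq// mulr_ge0 ?sqr_ge0.
set X := (X in X <= _).
have approx e : 0 < e -> e <= 1 ->
    X <= C0 * (1 + e) * c ^+ 2 * ((a + e) ^+ 2 * (b + e) ^+ 2).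
  move=> e0 e1.
  have lt3 (u : R) : 0 <= u -> u ^+ 3 < (u + e) ^+ 3.
    by move=> u0; rewrite ltrXn2r ?nnegrE// ?ltrDl//; lra.
  have ae : 0 < a + e by lra.
  have be : 0 < b + e by lra.
  have [phi' [p0 p1 p2]] :=
    normalize_sum M0 phi0 ae (le_lt_trans phia (lt3 _ a0)).
  have [psi' [q0 q1 q2]] :=
    normalize_sum M0 psi0 be (le_lt_trans psib (lt3 _ b0)).
  have Y := young_normalized e0 e1 p0 q0 chi0 kap0 c0 p2 q2 chic kapchi.
  have ab0 : 0 <= (a + e) ^+ 2 * (b + e) ^+ 2 by rewrite mulr_ge0 ?sqr_ge0.
  apply: le_trans (ler_wpM2r ab0 Y); rewrite mulr_suml; apply: ler_sum => i _.
  rewrite mulr_suml; apply: ler_sum => j _.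
  have -> : phi' i ^+ 2 * psi' j ^+ 2 * kap i j ^+ 2 *
      ((a + e) ^+ 2 * (b + e) ^+ 2) =
      ((a + e) * phi' i) ^+ 2 * ((b + e) * psi' j) ^+ 2 * kap i j ^+ 2 by ring.
  rewrite ler_wpM2r ?sqr_ge0//.
  apply: ler_pM; rewrite ?sqr_ge0//.
    by rewrite lerXn2r ?nnegrE ?phi0 ?mulr_ge0 ?(ltW ae) ?(ltW (p0 i)).
  by rewrite lerXn2r ?nnegrE ?psi0 ?mulr_ge0 ?(ltW be) ?(ltW (q0 j)).
(* For [e <= 1] the quadratic term [e ^ 2] is absorbed into the linear one. *)
have prod e (P P' Q Q' : R) : 0 < e -> e <= 1 -> 0 <= P' -> 0 <= Q' ->
    (P + e * P') * (Q + e * Q') <= P * Q + e * (P * Q' + P' * Q + P' * Q').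
  move=> e0 e1 P0 Q0; have : 0 <= e * (1 - e) * (P' * Q').
    by rewrite !mulr_ge0 ?subr_ge0// ltW.
  lra.
pose T := a ^+ 2 * (2 * b + 1) + (2 * a + 1) * b ^+ 2 + (2 * a + 1) * (2 * b + 1).
have T0 : 0 <= T.
  by rewrite /T; apply: addr_ge0; [apply: addr_ge0|];
    rewrite mulr_ge0 ?sqr_ge0//; lra.
pose T' := T + a ^+ 2 * b ^+ 2 + T.
have ab0 : 0 <= a ^+ 2 * b ^+ 2 by rewrite mulr_ge0 ?sqr_ge0.
have Cc : 0 <= C0 * c ^+ 2 by rewrite mulr_ge0 ?sqr_ge0.
apply: (@le_of_affine _ _ (C0 * c ^+ 2 * T')).
  by apply: mulr_ge0 => //; rewrite /T'; lra.
move=> e e0 e1; apply: le_trans (approx _ e0 e1) _.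
have sq (u : R) : (u + e) ^+ 2 <= u ^+ 2 + e * (2 * u + 1) by nra.
have h1 : (a + e) ^+ 2 * (b + e) ^+ 2 <= a ^+ 2 * b ^+ 2 + e * T.
  apply: le_trans (prod _ _ _ _ _ e0 e1 _ _); last 2 first.
  - by lra.
  - by lra.
  by rewrite ler_pM ?sqr_ge0.
have h2 : (1 + e) * ((a + e) ^+ 2 * (b + e) ^+ 2) <= a ^+ 2 * b ^+ 2 + e * T'.
  have := prod e 1 1 (a ^+ 2 * b ^+ 2) T e0 e1 ler01 T0.
  rewrite mulr1 !mul1r -/T'; apply: le_trans.
  by rewrite ler_wpM2l//; lra.
have := ler_wpM2l Cc h2 => h3.
have e3 : C0 * (1 + e) * c ^+ 2 * ((a + e) ^+ 2 * (b + e) ^+ 2) =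
  C0 * c ^+ 2 * ((1 + e) * ((a + e) ^+ 2 * (b + e) ^+ 2)) by ring.
rewrite e3; apply: le_trans h3 _; rewrite le_eqVlt; apply/orP; left; apply/eqP.
by ring.
Qed.

(** Reversing the second index, [j] to [M - 1 - j], turns sums into differences. *)
Lemma young_line_diff M (phi psi chi : nat -> R) (kap : nat -> nat -> R)
    (a b c : R) :
  (forall i, 0 <= phi i) -> (forall j, 0 <= psi j) -> (forall k, 0 <= chi k) ->
  (forall i j, 0 <= kap i j) -> 0 <= a -> 0 <= b -> 0 <= c ->
  \sum_(0 <= i < M) phi i ^+ 3 <= a ^+ 3 ->
  \sum_(0 <= j < M) psi j ^+ 3 <= b ^+ 3 ->
  \sum_(0 <= k < 2 * M + 5) chi k ^+ 3 <= c ^+ 3 ->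
  (forall i j k, (i < M)%N -> (j < M)%N ->
     (i + M <= k + j.+1 <= i + M + 5)%N -> kap i j <= chi k) ->
  \sum_(0 <= i < M) \sum_(0 <= j < M) phi i ^+ 2 * psi j ^+ 2 * kap i j ^+ 2 <=
    C0 * (a * b * c) ^+ 2.
Proof.
move=> phi0 psi0 chi0 kap0 a0 b0 c0 phia psib chic kapchi.
have := @young_line M phi (fun j => psi (0 + M - j.+1)%N) chi
  (fun i j => kap i (0 + M - j.+1)%N) a b c.
have rev (F : nat -> R) :
    \sum_(0 <= j < M) F (0 + M - j.+1)%N = \sum_(0 <= j < M) F j.
  by rewrite [RHS]big_nat_rev.
rewrite (rev (fun j => psi j ^+ 3)) (eq_bigr _ (fun i _ =>
  rev (fun j => phi i ^+ 2 * psi j ^+ 2 * kap i j ^+ 2))).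
apply => // i j k iM jM ijk; apply: kapchi => //; first by clear -jM; lia.
by clear -jM ijk; lia.
Qed.

Fixpoint box d M : seq (seq nat) :=
  if d is d'.+1 then [seq i :: s | i <- index_iota 0 M, s <- box d' M]
  else [:: [::]].

Lemma mem_box d M s :
  (s \in box d M) = (size s == d) && all (fun i => (i < M)%N) s.
Proof.
elim: d s => [|d IH] [|i s] //=.
- by apply/negbTE/negP => /allpairsP[[j t] /= [_ _]].
- apply/allpairsP/idP => [[[j t] /= [jM ts [-> ->]]]|].
    move: jM ts; rewrite mem_index_iota IH eqSS => /andP[_ ->] /andP[-> ->].
    by [].
  rewrite eqSS => /and3P[sd iM sM]; exists (i, s); split => //=.
    by rewrite mem_index_iota.
  by rewrite IH sd.
Qed.

Lemma box_uniq d M : uniq (box d M).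
Proof.
elim: d => //= d IH; apply: allpairs_uniq => //; first exact: iota_uniq.
by move=> [i s] [j t] _ _ /= [-> ->].
Qed.

Lemma size_box d M : size (box d M) = (M ^ d)%N.
Proof.
by elim: d => //= d IH; rewrite size_allpairs IH size_iota subn0 expnS.
Qed.

(* Reading [z] with the offset [M + 1], this says that the coordinates of
   [z - (x - y)] lie between [-2] and [3]. *)
Fixpoint near_diff M (x y z : seq nat) : bool :=
  match x, y, z with
  | [::], [::], [::] => true
  | i :: x', j :: y', k :: z' =>
      (i + M <= k + j.+1 <= i + M + 5)%N && near_diff M x' y' z'
  | _, _, _ => false
  end.

(** Induction on the dimension: the inequality holds on slices with fixed first coordinates, and the
    one-dimensional case is then applied to the slice norms [N]. *)
Lemma young_box d M (phi psi chi : seq nat -> R)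
    (kap : seq nat -> seq nat -> R) (a b c : R) :
  (forall x, 0 <= phi x) -> (forall x, 0 <= psi x) -> (forall x, 0 <= chi x) ->
  (forall x y, 0 <= kap x y) -> 0 <= a -> 0 <= b -> 0 <= c ->
  \sum_(x <- box d M) phi x ^+ 3 <= a ^+ 3 ->
  \sum_(y <- box d M) psi y ^+ 3 <= b ^+ 3 ->
  \sum_(z <- box d (2 * M + 5)) chi z ^+ 3 <= c ^+ 3 ->
  (forall x y z, x \in box d M -> y \in box d M -> near_diff M x y z ->
     kap x y <= chi z) ->
  \sum_(x <- box d M) \sum_(y <- box d M)
      phi x ^+ 2 * psi y ^+ 2 * kap x y ^+ 2 <=
    C0 ^+ d * (a * b * c) ^+ 2.
Proof.
have C00 : 0 < C0 by rewrite divr_gt0 ?sqrtr_gt0.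
elim: d phi psi chi kap a b c => [|d IH] phi psi chi kap a b c
  phi0 psi0 chi0 kap0 a0 b0 c0.
  rewrite !big_seq1 => phia psib chic /(_ [::] [::] [::]).
  rewrite /= mem_seq1 eqxx => /(_ isT isT isT) kapchi.
  rewrite !ler_cube// in phia psib chic.
  have kapc := le_trans kapchi chic.
  rewrite expr0 mul1r -!exprMn lerXn2r ?nnegrE ?mulr_ge0//.
  by rewrite !ler_pM ?mulr_ge0.
rewrite /= !big_allpairs_dep/= => phia psib chic kapchi.
pose N (f : seq nat -> R) M' i := cbrt (\sum_(x <- box d M') f (i :: x) ^+ 3).
have N_ge0 f M' i : 0 <= N f M' i by exact: cbrt_ge0.
have NK f M' i : (forall x, 0 <= f x) ->
    N f M' i ^+ 3 = \sum_(x <- box d M') f (i :: x) ^+ 3.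
  by move=> f0; rewrite cbrtK// sumr_ge0// => x _; rewrite exprn_ge0.
pose S i j := \sum_(x <- box d M) \sum_(y <- box d M)
  phi (i :: x) ^+ 2 * psi (j :: y) ^+ 2 * kap (i :: x) (j :: y) ^+ 2.
pose D i j := C0 ^+ d * (N phi M i * N psi M j) ^+ 2.
have D_ge0 i j : 0 <= D i j by rewrite mulr_ge0 ?sqr_ge0// exprn_ge0// ltW.
have S_ge0 i j : 0 <= S i j.
  apply: sumr_ge0 => x _; apply: sumr_ge0 => y _.
  by apply: mulr_ge0; rewrite ?mulr_ge0 ?sqr_ge0.
have SD i j k : (i < M)%N -> (j < M)%N -> (i + M <= k + j.+1 <= i + M + 5)%N ->
    S i j <= D i j * N chi (2 * M + 5)%N k ^+ 2.
  move=> iM jM ijk; rewrite /D -mulrA -exprMn.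
  apply: (IH (fun x => phi (i :: x)) (fun y => psi (j :: y))
    (fun z => chi (k :: z)) (fun x y => kap (i :: x) (j :: y))) => //.
  - by rewrite NK.
  - by rewrite NK.
  - by rewrite NK.
  - move=> x y z xb yb xyz; apply: kapchi; rewrite /= ?ijk//.
      by apply: allpairs_f => //; rewrite mem_index_iota.
    by apply: allpairs_f => //; rewrite mem_index_iota.
(* The kernel left for the first coordinate, chosen so that [S = D * kap1 ^ 2]. If [D] is 0, then
   [S] is 0 too by [SD] at the admissible index [k = i + M - j - 1]. *)
pose kap1 i j := Num.sqrt (S i j / D i j).
have SE i j : (i < M)%N -> (j < M)%N -> S i j = D i j * kap1 i j ^+ 2.
  move=> iM jM; rewrite sqr_sqrtr ?divr_ge0//.
  have [D0|D0] := eqVneq (D i j) 0; last by rewrite mulrC divfK.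
  apply/eqP; rewrite D0 mul0r eq_le S_ge0 andbT.
  have := @SD i j (i + M - j.+1)%N iM jM; rewrite D0 mul0r; apply.
  by clear -jM; lia.
have -> : \sum_(i <- index_iota 0 M) \sum_(x <- box d M)
    \sum_(y <- [seq j :: s | j <- index_iota 0 M, s <- box d M])
      phi (i :: x) ^+ 2 * psi y ^+ 2 * kap (i :: x) y ^+ 2 =
    C0 ^+ d * \sum_(0 <= i < M) \sum_(0 <= j < M)
      N phi M i ^+ 2 * N psi M j ^+ 2 * kap1 i j ^+ 2.
  rewrite mulr_sumr; apply: eq_big_nat => i /andP[_ iM].
  under eq_bigr do rewrite big_allpairs_dep/=.
  rewrite exchange_big/= mulr_sumr; apply: eq_big_nat => j /andP[_ jM].
  by rewrite -/(S i j) SE// /D [(N _ _ _ * _) ^+ 2]exprMn !mulrA.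
rewrite exprSr -mulrA ler_pM2l ?exprn_gt0//.
apply: (@young_line_diff _ _ _ (N chi (2 * M + 5)%N)) => //.
- by move=> i j; exact: sqrtr_ge0.
- by rewrite (eq_bigr _ (fun i _ => NK _ _ i _)).
- by rewrite (eq_bigr _ (fun i _ => NK _ _ i _)).
- by rewrite (eq_bigr _ (fun i _ => NK _ _ i _)).
- move=> i j k iM jM ijk.
  rewrite -(ler_pXn2r (n := 2)) ?nnegrE ?sqrtr_ge0// sqr_sqrtr ?divr_ge0//.
  have [D0|D0] := eqVneq (D i j) 0; first by rewrite D0 invr0 mulr0 sqr_ge0.
  by rewrite ler_pdivrMr ?lt0r ?D0 ?D_ge0// mulrC SD.
Qed.

End YoungBox.

(** * Lattice points of dilates of a convex body *)

Section LatticePoints.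
Context {R : realType} {d : nat}.
Implicit Types (v w : 'rV[R]_d) (s : seq nat) (P Q : set 'rV[R]_d).

(* The integer point with coordinates [s_i - o]: lattice points are encoded by
   lists of naturals together with an offset [o]. *)
Definition lattice_point o s : 'rV[R]_d := \row_i ((nth 0%N s i)%:R - o%:R).

Definition lattice_points M o P : seq (seq nat) :=
  [seq s <- box d M | `[< P (lattice_point o s) >]].

Lemma lattice_points_uniq M o P : uniq (lattice_points M o P).
Proof. by rewrite filter_uniq// box_uniq. Qed.

Lemma lattice_pointsP M o P s :
  s \in lattice_points M o P -> s \in box d M /\ P (lattice_point o s).
Proof. by rewrite mem_filter => /andP[/asboolP]. Qed.

Lemma size_lattice_points M o M' o' P :
  (forall v i, P v -> `|v 0 i| <= o'%:R) -> ((2 * o').+1 <= M')%N ->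
  (size (lattice_points M o P) <= size (lattice_points M' o' P))%N.
Proof.
move=> Po oM; pose f := map (fun n => n + o' - o)%N.
have coord s i : s \in lattice_points M o P -> (i < d)%N ->
    (o <= nth 0 s i + o' /\ nth 0 s i <= o + o')%N.
  move=> /lattice_pointsP[_ /Po h] id; have := h (Ordinal id); rewrite mxE/=.
  by rewrite ler_norml => /andP[h1 h2]; split; rewrite -(ler_nat R) natrD; lra.
have sized s : s \in lattice_points M o P -> size s = d.
  by move=> /lattice_pointsP[+ _]; rewrite mem_box => /andP[/eqP].
rewrite -(size_map f); apply: uniq_leq_size.
  rewrite map_inj_in_uniq ?lattice_points_uniq// => s s' hs hs' e.
  apply: (@eq_from_nth _ 0%N); first by rewrite !sized.
  move=> i; rewrite sized// => id.
  have := congr1 (fun t => nth 0%N t i) e.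
  rewrite /f !(nth_map 0%N) ?sized//.
  have [a1 _] := coord _ _ hs id; have [a2 _] := coord _ _ hs' id.
  by clear -a1 a2; lia.
move=> t /mapP[s hs ->]; have [sb Ps] := lattice_pointsP hs.
rewrite mem_filter; apply/andP; split.
  apply/asboolP; rewrite (_ : lattice_point _ _ = lattice_point o s)//.
  apply/rowP => i; rewrite !mxE (nth_map 0%N) ?sized//.
  have [a1 _] := coord _ _ hs (ltn_ord i).
  by rewrite natrB// natrD; ring.
rewrite mem_box size_map sized// eqxx; apply/(all_nthP 0%N) => i.
rewrite size_map sized// => id; rewrite (nth_map 0%N) ?sized//.
have [a1 a2] := coord _ _ hs id.
by clear -a1 a2 oM; lia.
Qed.

Lemma near_diff_coord M x y z i : near_diff M x y z -> (i < size x)%N ->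
  `|(nth 0%N z i)%:R - M.+1%:R - ((nth 0%N x i)%:R - (nth 0%N y i)%:R)| <= 3 :> R.
Proof.
elim: x y z i => [|a x IH] [|b y] [|c z] //= [|i] /= /andP[h1 h2] hi;
  last exact: IH.
have /andP[h3 h4] := h1.
have h5 : (a + M)%:R <= (c + b.+1)%:R :> R by rewrite ler_nat.
have h6 : (c + b.+1)%:R <= (a + M + 5)%:R :> R by rewrite ler_nat.
move: h5 h6; rewrite !natrD -!natr1 => h5 h6.
by rewrite ler_norml; lra.
Qed.

(** Young's inequality for the indicators of [P], [P] and [Q], with norm parameters [cbrt N],
    [cbrt N] and [2 cbrt N], as [8 N = (2 cbrt N) ^ 3]; hence the factor [4 N ^ 2]. *)
Lemma bad_pairs_bound M o P Q (N : R) :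
  (forall v w, P v -> (forall i, `|w 0 i| <= 3) -> Q (v + w)) ->
  (size (lattice_points M o P))%:R = N ->
  (size (lattice_points (2 * M + 5) M.+1 Q))%:R <= 8 * N ->
  \sum_(x <- lattice_points M o P) \sum_(y <- lattice_points M o P)
      (`[< P (lattice_point o x - lattice_point o y) >] : nat)%:R <=
    (Num.sqrt 3 / 2) ^+ d * (4 * N ^+ 2).
Proof.
move=> PQ sN sQ; set V := lattice_points M o P in sN *.
have N0 : 0 <= N by rewrite -sN.
pose phi x : R := (`[< P (lattice_point o x) >] : nat)%:R.
pose chi x : R := (`[< Q (lattice_point M.+1 x) >] : nat)%:R.
pose kap x y : R := (`[< P (lattice_point o x - lattice_point o y) >] : nat)%:R.
have b3 (b : bool) : (b : nat)%:R ^+ 3 = (b : nat)%:R :> R.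
  by case: b; rewrite ?expr1n ?expr0n.
have b2 (b : bool) : (b : nat)%:R ^+ 2 = (b : nat)%:R :> R.
  by case: b; rewrite ?expr1n ?expr0n.
have count_sum (T : Type) (r : seq T) (b : pred T) :
    \sum_(x <- r) (b x : nat)%:R ^+ 3 = (size [seq x <- r | b x])%:R :> R.
  rewrite size_filter -sum1_count natr_sum [RHS]big_mkcond/=.
  by apply: eq_bigr => x _; rewrite b3; case: (b x).
have phiN : \sum_(x <- box d M) phi x ^+ 3 <= cbrt N ^+ 3.
  by rewrite count_sum -/V sN cbrtK.
have chiN : \sum_(x <- box d (2 * M + 5)) chi x ^+ 3 <= (2 * cbrt N) ^+ 3.
  rewrite count_sum exprMn cbrtK//; apply: le_trans sQ _.
  by rewrite ler_wpM2r//; lra.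
have := @young_box R d M phi phi chi kap (cbrt N) (cbrt N) (2 * cbrt N).
have -> : (cbrt N * cbrt N * (2 * cbrt N)) ^+ 2 = 4 * (cbrt N ^+ 3) ^+ 2 by ring.
have cN0 : 0 <= cbrt N by exact: cbrt_ge0.
have cN1 : 0 <= 2 * cbrt N by rewrite mulr_ge0.
move=> /(_ (fun=> ler0n _ _) (fun=> ler0n _ _) (fun=> ler0n _ _)
  (fun _ _ => ler0n _ _) cN0 cN0 cN1 phiN phiN chiN) young.
rewrite cbrtK// in young; apply: le_trans (young _).
- rewrite /V /lattice_points big_filter big_mkcond/=; apply: ler_sum => x _.
  rewrite big_filter; case: asboolP => [Px|_]; last first.
    by apply: sumr_ge0 => y _; rewrite !mulr_ge0 ?sqr_ge0.
  rewrite big_mkcond/=; apply: ler_sum => y _.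
  have -> : phi x = 1 by rewrite /phi asboolT.
  rewrite expr1n mul1r /phi /kap !b2.
  by case: asboolP => _; rewrite ?mul1r ?mul0r.
- move=> x y z xb yb xyz; rewrite /kap /chi ler_nat.
  case: asboolP => // Pxy; rewrite asboolT//.
  rewrite -(subrK (lattice_point o x - lattice_point o y) (lattice_point _ z)).
  rewrite addrC; apply: PQ => // i; rewrite !mxE.
  have := near_diff_coord xyz (i := i).
  move: xb; rewrite mem_box => /andP[/eqP-> _] /(_ (ltn_ord i)).
  congr (`|_| <= _); ring.
Qed.

End LatticePoints.

(** * Large sets without differences in a convex body *)

Section SeparatedSets.
Context {R : realType} {d : nat}.
Variable L : set 'rV[R]_d.
Variables r B : R.
Hypothesis d_gt0 : (0 < d)%N.
Hypothesis r_gt0 : 0 < r.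
Hypothesis L_convex : forall (v w : 'rV[R]_d) (t : R), L v -> L w -> 0 <= t -> t <= 1 ->
  L ((1 - t) *: v + t *: w).
Hypothesis L_inner : forall v : 'rV[R]_d, (forall i, `|v 0 i| <= r) -> L v.
Hypothesis L_outer : forall (v : 'rV[R]_d) i, L v -> `|v 0 i| <= B.

Definition dilate t : set 'rV[R]_d := [set v | L (t^-1 *: v)].

(** The rescaled [v + w] is a convex combination of [v / t], in [L], and [w / (e t)], in the cube of
    half-side [r] inside [L]. *)
Lemma dilate_neighbourhood t e (v w : 'rV[R]_d) : 0 < t -> 0 < e -> 3 <= e * t * r ->
  dilate t v -> (forall i, `|w 0 i| <= 3) -> dilate ((1 + e) * t) (v + w).
Proof.
move=> t0 e0 h Lv hw; rewrite /dilate/=.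
have e1 : 0 < 1 + e by rewrite addr_gt0.
have -> : ((1 + e) * t)^-1 *: (v + w) =
    (1 - e / (1 + e)) *: (t^-1 *: v) + (e / (1 + e)) *: ((e * t)^-1 *: w).
  rewrite scalerDr !scalerA; congr (_ *: _ + _ *: _); field.
    by rewrite !gt_eqF.
  by rewrite !gt_eqF.
apply: L_convex => //.
- apply: L_inner => i; rewrite mxE normrM normfV [`|e * t|]gtr0_norm ?mulr_gt0//.
  rewrite ler_pdivrMl ?mulr_gt0//; exact: le_trans (hw i) h.
- by rewrite divr_ge0// ltW.
- by rewrite ler_pdivrMr// mul1r lerDr.
Qed.

(** Turán's bound on the lattice points of a dilate [t L], scaled back by [1 / t]; the factor 1/8 is
    the 4 of the bad pair bound, doubled by symmetrization. *)
Lemma separated_set : exists S : seq 'rV[R]_d,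
  [/\ uniq S, forall v, v \in S -> L v,
    forall v w, v \in S -> w \in S -> v != w -> ~ L (v - w) &
    8^-1 * (2 / Num.sqrt 3) ^+ d <= (size S)%:R :> R].
Proof.
(* This choice gives [(1 + e) ^ d <= 2], safely below the growth factor 8 allowed between
   consecutive dilates. *)
pose e : R := (2 * d%:R)^-1.
have dR : 0 < d%:R :> R by rewrite ltr0n.
have e0 : 0 < e by rewrite invr_gt0 mulr_gt0.
have ed : 2 * d%:R * e = 1 by rewrite divff// gt_eqF// mulr_gt0.
have e1 : 0 < 1 + e by rewrite addr_gt0.
have growth : (1 + e) ^+ d <= 2.
  suff h j : (j <= d)%N -> (1 + e) ^+ j <= 1 + 2 * j%:R * e.
    by apply: le_trans (h _ (leqnn _)) _; rewrite ed.
  elim: j => [|j IH] jd; first by rewrite expr0 mulr0 mul0r addr0.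
  rewrite exprS; apply: le_trans (ler_wpM2l (ltW e1) (IH (ltnW jd))) _.
  have : j%:R <= d%:R :> R by rewrite ler_nat ltnW.
  rewrite -natr1 => jdR.
  have : 2 * j%:R * e <= 1 by rewrite -[leRHS]ed ler_pM2r// ler_pM2l.
  nra.
have B_gt0 : 0 < B.
  apply: lt_le_trans r_gt0 _.
  have := @L_outer (const_mx r) (Ordinal d_gt0); rewrite mxE gtr0_norm//.
  by apply; apply: L_inner => i; rewrite mxE gtr0_norm.
pose t k := (1 + e) ^+ k.
have t_gt0 k : 0 < t k by rewrite exprn_gt0.
have t_ge1 k : 1 <= t k by rewrite exprn_ege1// lerDl ltW.
pose o k := (Num.trunc (B * t k)).+1.
have oB k : B * t k <= (o k)%:R by rewrite ltW// truncnS_gt.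
pose V k := lattice_points (2 * o k).+1 (o k) (dilate (t k)).
pose u k : R := (size (V k))%:R.
have dilate_bound k v i : dilate (t k) v -> `|v 0 i| <= (o k)%:R.
  move=> /L_outer-/(_ i); rewrite mxE normrM normfV [`|t k|]gtr0_norm//.
  by rewrite ler_pdivrMl// mulrC => /le_trans; apply.
have L0 : L 0 by apply: L_inner => i; rewrite mxE normr0 ltW.
have u_gt0 k : 0 < u k.
  rewrite ltr0n -has_predT; apply/hasP; exists (nseq d (o k)) => //.
  rewrite mem_filter mem_box size_nseq eqxx all_nseq/=; apply/andP; split.
    apply/asboolP; rewrite /dilate/= (_ : lattice_point _ _ = 0) ?scaler0//.
    by apply/rowP => i; rewrite !mxE nth_nseq ltn_ord subrr.
  by apply/orP; right; clear; lia.
(* The box has side [2 o k + 1], at most [(2 B + 3) t k] because [t k >= 1]. *)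
have u_ub k : u k <= (2 * B + 3) ^+ d * ((1 + e) ^+ d) ^+ k.
  apply: (@le_trans _ _ ((2 * o k).+1 ^ d)%:R).
    rewrite ler_nat -size_box size_filter; exact: count_size.
  rewrite natrX exprAC -exprMn lerXn2r ?nnegrE//.
    by rewrite mulr_ge0 ?(ltW (t_gt0 k))//; have := B_gt0; lra.
  rewrite -natr1 natrM -/(t k).
  have : (o k)%:R <= B * t k + 1.
    by rewrite /o -natr1 lerD2r truncn_le mulr_ge0// ltW.
  by have := t_ge1 k; nra.
have [K hK] : exists K, forall k, (K <= k)%N -> 3 <= e * t k * r.
  pose K := (Num.trunc (3 / (e * e * r))).+1; exists K => k Kk.
  have eer : 0 < e * e * r by rewrite !mulr_gt0.
  have : 3 <= K%:R * (e * e * r) by rewrite -ler_pdivrMr// ltW// truncnS_gt.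
  have : K%:R <= k%:R :> R by rewrite ler_nat.
  rewrite -(ler_pM2r eer) => h1 h2.
  have := bernoulli_le k (ltW e0); rewrite -/(t k) => h3.
  have er : 0 < e * r by rewrite mulr_gt0.
  by move: h3; rewrite -(ler_pM2r er); lra.
have [|||k Kk hk] := @slow_growth R u ((2 * B + 3) ^+ d) ((1 + e) ^+ d) 8 K u_gt0.
- by rewrite exprn_gt0.
- by apply: le_lt_trans growth _; lra.
- exact: u_ub.
have bad : \sum_(x <- V k) \sum_(y <- V k)
    (`[< dilate (t k) (lattice_point (o k) x - lattice_point (o k) y) >]
      : nat)%:R <= (Num.sqrt 3 / 2) ^+ d * (4 * u k ^+ 2).
  apply: (@bad_pairs_bound _ _ _ _ _ (dilate (t k.+1))) => //.
    move=> v w hv hw; rewrite /t exprS; apply: dilate_neighbourhood => //.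
    exact: hK.
  apply: le_trans hk; rewrite ler_nat; apply: size_lattice_points => // v i.
  exact: dilate_bound.
pose rel1 x y :=
  `[< dilate (t k) (lattice_point (o k) x - lattice_point (o k) y) >].
(* Symmetrized, since [L] need not be symmetric about the origin. *)
pose rel x y := rel1 x y || rel1 y x.
have [||S [uS SV Sind hS]] :=
  @independent_subset _ rel (V k) _ _ (lattice_points_uniq _ _ _).
- by move=> x y; rewrite /rel orbC.
- move=> x _; rewrite /rel /rel1 asboolT// /dilate/= subrr scaler0.
  exact: L0.
pose f (s : seq nat) : 'rV[R]_d := (t k)^-1 *: lattice_point (o k) s.
have indep (x y : seq nat) : x \in S -> y \in S -> x != y -> ~ L (f x - f y).
  move=> xS yS xy Lxy; have := Sind _ _ xS yS xy.
  by rewrite /rel /rel1 asboolT// /dilate/= scalerBr.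
exists (map f S); split.
- rewrite map_inj_in_uniq// => x y xS yS fxy.
  apply/eqP; apply: contraPT L0 => xy; have := indep _ _ xS yS xy.
  by rewrite fxy subrr.
- by move=> v /mapP[x /SV /lattice_pointsP[_ h] ->].
- move=> v w /mapP[x xS ->] /mapP[y yS ->] fxy; apply: indep => //.
  by apply: contra_neq fxy => ->.
rewrite size_map; set m := size S in hS *.
have relsum : (\sum_(x <- V k) \sum_(y <- V k) (rel x y : nat))%:R <=
    2 * ((Num.sqrt 3 / 2) ^+ d * (4 * u k ^+ 2)) :> R.
  have h : (\sum_(x <- V k) \sum_(y <- V k) (rel x y : nat))%:R <=
      \sum_(x <- V k) \sum_(y <- V k) (rel1 x y : nat)%:R +
      \sum_(x <- V k) \sum_(y <- V k) (rel1 y x : nat)%:R :> R.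
    rewrite natr_sum -big_split/=; apply: ler_sum => x _.
    rewrite natr_sum -big_split/=; apply: ler_sum => y _.
    by rewrite /rel -natrD ler_nat; do 2 case: (rel1 _ _).
  rewrite [X in _ + X]exchange_big/= in h.
  by apply: le_trans h _; have := bad; rewrite /rel1; lra.
have hm : u k ^+ 2 <= m%:R * (2 * ((Num.sqrt 3 / 2) ^+ d * (4 * u k ^+ 2))).
  apply: le_trans (_ : (m * \sum_(x <- V k) \sum_(y <- V k) rel x y)%:R <= _).
    by rewrite -natrX ler_nat.
  by rewrite natrM ler_wpM2l.
have s3 : 0 < Num.sqrt 3 :> R by rewrite sqrtr_gt0.
have CC : (2 / Num.sqrt 3) ^+ d * (Num.sqrt 3 / 2) ^+ d = 1 :> R.
  rewrite -exprMn (_ : _ * _ = 1) ?expr1n//; field.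
  by rewrite gt_eqF.
have C0 : 0 < (2 / Num.sqrt 3) ^+ d :> R by rewrite exprn_gt0// divr_gt0.
have u2 : 0 < u k ^+ 2 by rewrite exprn_gt0.
have h8 : 1 <= 8 * m%:R * (Num.sqrt 3 / 2) ^+ d :> R.
  rewrite -(ler_pM2r u2) mul1r; apply: le_trans hm _.
  by rewrite le_eqVlt; apply/orP; left; apply/eqP; ring.
have := ler_wpM2l (ltW C0) h8.
have -> : (2 / Num.sqrt 3) ^+ d * (8 * m%:R * (Num.sqrt 3 / 2) ^+ d) =
  8 * m%:R * ((2 / Num.sqrt 3) ^+ d * (Num.sqrt 3 / 2) ^+ d) :> R by ring.
rewrite CC !mulr1; lra.
Qed.

End SeparatedSets.

(** * From separated sets to Minkowski arrangements *)

Theorem theorem5 (R : realType) :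
  exists c : R, 0 < c /\
    forall (d : nat), (1 <= d)%N ->
    forall (K : set 'rV[R]_d) (p : 'rV[R]_d),
      convex_body K -> interior K p ->
      kappa'_gt K p (c * (2 / Num.sqrt 3) ^+ d).
Proof.
(* Half of the 1/8 of [separated_set], to make the inequality strict. *)
exists 16^-1; split; first by rewrite invr_gt0.
move=> d d1 K p [Kcompact Kconvex _] /nbhs_ballP[e /= e0 pK].
pose L : set 'rV[R]_d := [set v | K (v + p)].
have Lconvex (v w : 'rV[R]_d) (t : R) :
    L v -> L w -> 0 <= t -> t <= 1 -> L ((1 - t) *: v + t *: w).
  move=> Lv Lw t0 t1; rewrite /L/=.
  have -> : (1 - t) *: v + t *: w + p = (1 - t) *: (v + p) + t *: (w + p).
    by rewrite !scalerDr addrACA -scalerDl subrK scale1r.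
  exact: Kconvex.
(* Balls are cubes for the sup norm; halving the radius puts the closed cube inside the open
   ball. *)
have Linner (v : 'rV[R]_d) : (forall i, `|v 0 i| <= e / 2) -> L v.
  move=> hv; apply: pK; split => // i j; rewrite /ball/= mxE opprD addrCA subrr addr0.
  rewrite normrN ord1; apply: le_lt_trans (hv j) _.
  by rewrite ltr_pdivrMr// ltr_pMr// ltr1n.
have [B B0 KB] := pinfty_ex_gt0 (compact_bounded Kcompact).
have Louter (v : 'rV[R]_d) i : L v -> `|v 0 i| <= B + `|p|.
  move=> Lv; apply: (@le_trans _ _ `|v|).
    rewrite [leRHS]mx_normrE.
    exact: (le_bigmax _ (fun ij : 'I_1 * 'I_d => `|v ij.1 ij.2|) (0, i)).
  have -> : v = (v + p) - p by rewrite addrK.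
  by apply: le_trans (ler_normB _ _) _; rewrite lerD2r; exact: KB.
have e2 : 0 < e / 2 by rewrite divr_gt0.
have [S [uS SL Ssep Ssize]] := separated_set d1 e2 Lconvex Linner Louter.
have q0 : 0 < (2 / Num.sqrt 3) ^+ d :> R.
  by rewrite exprn_gt0// divr_gt0// sqrtr_gt0.
(* The arrangement consists of the translates of [K] by the points of [S]; [v_i + p] lies in
   [v_j + K] exactly when [v_i - v_j] is in [L]. *)
exists (size S), (fun i => nth 0 S i), (fun=> 1); split; last by lra.
split => // [i j ij [x Kx]|i j].
  rewrite scale1r => xE.
  apply: (Ssep (nth 0 S i) (nth 0 S j)); rewrite ?mem_nth// ?nth_uniq//.
  by rewrite /L/= addrAC -xE addrC addKr.
have Li := SL _ (mem_nth 0 (ltn_ord i)); have Lj := SL _ (mem_nth 0 (ltn_ord j)).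
(* Two translates share [v_i + v_j + p], as both [v_i + p] and [v_j + p] are in [K]. *)
exists (nth 0 S i + nth 0 S j + p); split.
  by exists (nth 0 S j + p) => //; rewrite scale1r addrA.
by exists (nth 0 S i + p) => //; rewrite scale1r addrA (addrC (nth 0 S j)).
Qed.
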